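(* Let $\Bbbk$ be a field of characteristic $2$, let $E$ be a $\Bbbk$-vector space of dimension $n=2m+1\ge 3$, and let $(q_0,q_1)$ be a regular pair of quadratic forms on $E$ with half-discriminant polynomial $\Delta(t_0,t_1)=a_0t_0^n+a_1t_0^{n-1}t_1+\cdots+a_nt_1^n$. Then there exist a basis $(x_0,\ldots,x_m,y_0,\ldots,y_{m-1})$ of the dual space $E^\vee$ and elements $r_0,\ldots,r_{n-2}\in\Bbbk$ such that \[ q_0=\sum_{i=0}^m a_{2i}x_i^2+\sum_{i=0}^{m-1}x_{i+1}y_i+\sum_{i=0}^{m-1}r_{2i+1}y_i^2,\qquad q_1=\sum_{i=0}^m a_{2i+1}x_i^2+\sum_{i=0}^{m-1}x_iy_i+\sum_{i=0}^{m-1}r_{2i}y_i^2, \] where $a_0,\ldots,a_n$ are the coefficients of the half-discriminant polynomial $\Delta$.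
   Context: A quadratic form on $E$ is an element $q\in S^2E^\vee$; its polar form $b(v,w)=q(v+w)-q(v)-q(w)$ is an alternating bilinear form. $|E|\cong\mathbb{P}^{2m}$ is the projective space of lines in $E$. The pair $(q_0,q_1)$ is regular if the subscheme $X=V(q_0,q_1)\subset |E|$ is smooth over $\Bbbk$ and of codimension $2$. Half-discriminant: fix a volume form on $E$ (an isomorphism $\bigwedge^nE\cong\Bbbk$). For a quadratic form $q$ with polar form $b$ and a basis $e_1,\ldots,e_n$ of $E$ with $e_1\wedge\cdots\wedge e_n\mapsto 1$, put $\omega=\sum_i \mathrm{Pf}_i\,e_i$, where $\mathrm{Pf}_i$ is the Pfaffian of the matrix $(b(e_j,e_k))_{j,k}$ with $i$-th row and column deleted; $\omega$ depends only on $b$ and the volume form. The half-discriminant of $q$ is $\tfrac12\mathrm{disc}(q):=q(\omega)$. It is a polynomial of degree $n$ in the coefficients of $q$, and $\Delta(t_0,t_1):=\tfrac12\mathrm{disc}(t_0q_0+t_1q_1)\in\Bbbk[t_0,t_1]$. *)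

(* Defs.v *)
From HB Require Import structures.
From mathcomp Require Import all_boot all_order all_algebra.
From mathcomp.multinomials Require Import mpoly.

Set Implicit Arguments.
Unset Strict Implicit.
Unset Printing Implicit Defensive.

Import GRing.Theory.
Local Open Scope ring_scope.

(* Elements of S^2 E^\vee are represented by the functions they define on E.
   The map from S^2 E^\vee to functions on E is injective over any field (the
   monomials X_i^2 and X_i X_j are linearly independent as functions even over
   F_2), and its image is given by the two conditions of [quadratic_form]. *)
Definition polar (F : fieldType) (E : vectType F) (q : E -> F) (v w : E) : F :=
  q (v + w) - q v - q w.

Definition quadratic_form (F : fieldType) (E : vectType F) (q : E -> F) :
    Prop :=
  (forall (a : F) (v : E), q (a *: v) = a ^+ 2 * q v) /\
  (forall v : E, scalar (polar q v) /\ scalar (polar q ^~ v)).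

Definition quad_poly (F : fieldType) (E : vectType F) (n : nat)
    (e : n.-tuple E) (q : E -> F) : {mpoly F[n]} :=
  \sum_(i < n) q (tnth e i) *: 'X_i ^+ 2 +
  \sum_(i < n) \sum_(j < n | (i < j)%N)
     polar q (tnth e i) (tnth e j) *: ('X_i * 'X_j).

(* A volume form, i.e. an isomorphism from the top exterior power of E to F,
   is a nonzero alternating n-linear form, where n is the dimension of E. *)
Definition tuple_upd (T : Type) (n : nat) (t : n.-tuple T) (i : 'I_n) (x : T) :
    n.-tuple T :=
  [tuple if j == i then x else tnth t j | j < n].

Definition volume_form (F : fieldType) (E : vectType F) (n : nat)
    (vol : n.-tuple E -> F) : Prop :=
  [/\ forall (t : n.-tuple E) (i : 'I_n),
        scalar (fun v : E => vol (tuple_upd t i v)),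
      forall (t : n.-tuple E) (i j : 'I_n),
        i != j -> tnth t i = tnth t j -> vol t = 0
    & exists t : n.-tuple E, vol t != 0].

(* Expansion along the first row; only meaningful for alternating A. *)
Fixpoint pfaffian (R : comNzRingType) (k : nat) : 'M[R]_k -> R :=
  match k return 'M[R]_k -> R with
  | 0 => fun _ => 1
  | 1 => fun _ => 0
  | k'.+2 => fun A =>
      \sum_(j < k'.+1) (-1) ^+ j * A ord0 (lift ord0 j) *
        pfaffian (row' j (row' ord0 (col' j (col' ord0 A))))
  end.

(* The half-discriminant, in a basis of volume 1, of the form with coordinate
   expression Q. The coefficients live in a ring, not just a field, because
   Delta below is the half-discriminant of a form over F[t_0, t_1]. *)
Definition polar_mx (R : comNzRingType) (n : nat) (Q : {mpoly R[n]}) :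
    'M[R]_n :=
  \matrix_(j, k) (Q.@[fun i => (i == j)%:R + (i == k)%:R] -
                  Q.@[fun i => (i == j)%:R] - Q.@[fun i => (i == k)%:R]).

Definition half_disc (R : comNzRingType) (n : nat) (Q : {mpoly R[n]}) : R :=
  Q.@[fun i => pfaffian (row' i (col' i (polar_mx Q)))].

Definition half_disc_pencil (F : fieldType) (E : vectType F) (n : nat)
    (e : n.-tuple E) (q0 q1 : E -> F) : {mpoly F[2]} :=
  half_disc ('X_(ord0 : 'I_2) *: map_mpoly (@mpolyC 2 F) (quad_poly e q0) +
             'X_(ord_max : 'I_2) *: map_mpoly (@mpolyC 2 F) (quad_poly e q1)).

(* Closed subschemes X = V(fs) of the projective space of lines in F^n, for a
   list fs of homogeneous polynomials. The points of X are studied through the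
   K-points of X_K, for all field extensions iota : F -> K. *)
Definition proj_point (F : fieldType) (n : nat) (fs : seq {mpoly F[n]})
    (K : fieldType) (iota : {rmorphism F -> K}) (x : 'I_n -> K) : Prop :=
  (exists i, x i != 0) /\ (forall f, f \in fs -> (map_mpoly iota f).@[x] = 0).

Definition homog_prime (K : fieldType) (n : nat) (P : {pred {mpoly K[n]}}) :
    Prop :=
  [/\ idealr_closed P, prime_idealr_closed P
    & forall f, f \in P -> forall d, pihomog mdeg d f \in P].

(* The inclusion of P in the homogeneous ideal of the point x is expressed on
   homogeneous components, so that it is also correct for finite K. *)
Definition prime_at (F : fieldType) (n : nat) (fs : seq {mpoly F[n]})
    (K : fieldType) (iota : {rmorphism F -> K}) (x : 'I_n -> K)
    (P : {pred {mpoly K[n]}}) : Prop :=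
  [/\ homog_prime P, forall f, f \in fs -> map_mpoly iota f \in P
    & forall f, f \in P -> forall d, (pihomog mdeg d f).@[x] = 0].

Definition prime_chain_at (F : fieldType) (n : nat) (fs : seq {mpoly F[n]})
    (K : fieldType) (iota : {rmorphism F -> K}) (x : 'I_n -> K) (d : nat) :
    Prop :=
  exists P : nat -> {pred {mpoly K[n]}},
    (forall i, (i <= d)%N -> prime_at fs iota x (P i)) /\
    (forall i, (i < d)%N ->
       {subset P i <= P i.+1} /\ exists2 f, f \in P i.+1 & f \notin P i).

(* The Krull dimension of the local ring of X_K at the rational point x is d:
   the primes of this local ring are the homogeneous primes of K[X_1, ..., X_n]
   that contain fs and are contained in the ideal of x. *)
Definition local_dim (F : fieldType) (n : nat) (fs : seq {mpoly F[n]})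
    (K : fieldType) (iota : {rmorphism F -> K}) (x : 'I_n -> K) (d : nat) :
    Prop :=
  prime_chain_at fs iota x d /\
  (forall d', prime_chain_at fs iota x d' -> (d' <= d)%N).

Definition jacobian_at (F : fieldType) (n : nat) (fs : seq {mpoly F[n]})
    (K : fieldType) (iota : {rmorphism F -> K}) (x : 'I_n -> K) :
    'M[K]_(size fs, n) :=
  \matrix_(i, j) (map_mpoly iota (mderiv j fs`_i)).@[x].

(* X is smooth over F: at every K-point x of X_K, the Zariski tangent space,
   of dimension (n - 1) - rank of the Jacobian, has the dimension of the local
   ring. *)
Definition smooth (F : fieldType) (n : nat) (fs : seq {mpoly F[n]}) : Prop :=
  forall (K : fieldType) (iota : {rmorphism F -> K}) (x : 'I_n -> K),
    proj_point fs iota x ->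
    exists2 d, local_dim fs iota x d &
      (\rank (jacobian_at fs iota x) + d)%N = n.-1.

(* X is nonempty and of pure codimension c. *)
Definition codimension (F : fieldType) (n : nat) (fs : seq {mpoly F[n]})
    (c : nat) : Prop :=
  (exists (K : fieldType) (iota : {rmorphism F -> K}) (x : 'I_n -> K),
     proj_point fs iota x) /\
  (forall (K : fieldType) (iota : {rmorphism F -> K}) (x : 'I_n -> K),
     proj_point fs iota x ->
     exists2 d, local_dim fs iota x d & (c + d)%N = n.-1).

(* The choice of the basis e, which identifies |E| with the projective space
   of lines in F^n, does not matter. *)
Definition regular_pair (F : fieldType) (E : vectType F) (n : nat)
    (e : n.-tuple E) (q0 q1 : E -> F) : Prop :=
  let X := [:: quad_poly e q0; quad_poly e q1] in
  smooth X /\ codimension X 2.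

(* Main.v *)
From Stdlib Require Import Classical Permutation.
Require Import Defs.
From HB Require Import structures.
From mathcomp Require Import all_boot all_order all_algebra.
From mathcomp.multinomials Require Import mpoly.
From mathcomp Require Import fieldext zify ring.

Set Implicit Arguments.
Unset Strict Implicit.
Unset Printing Implicit Defensive.

Import GRing.Theory.
Local Open Scope ring_scope.

(** Write [n = 2 m + 1] and let [b0], [b1] be the polar forms, which are
    symmetric and alternating. A quadratic form is determined by its polar form
    and its values on a basis, so it is enough to find a basis
    [w_0, ..., w_m, u_0, ..., u_(m-1)] of [E] in which [b0] and [b1] have the
    shape of a single Kronecker block,
    [b0 (w_(j+1), u_j) = b1 (w_j, u_j) = 1] and all other values 0, and such
    that [q0 (w_i) = a_(2 i)] and [q1 (w_i) = a_(2 i + 1)]; the remaining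
    values [q0 (u_i)], [q1 (u_i)] are the coefficients [r].

    The [w_l] are the coefficients of the vector
    [omega (t) = w_0 + t w_1 + ... + t^m w_m] of sub-Pfaffians of [b0 + t b1].
    This vector lies in the kernel of [b0 + t b1] ([pf_vector_ker]), which
    means that [b0 (w_0, -) = 0], [b0 (w_(l+1), -) = b1 (w_l, -)] and
    [b1 (w_m, -) = 0].

    Smoothness enters through the Jacobian criterion: no common zero of [q0]
    and [q1], over any extension field, lies in the radical of a member of the
    pencil of polar forms ([regular_pair_pencil]). If [omega] vanished at some
    point of the projective line, the radical there would have dimension at
    least 3 ([pf_vector_eq0]), and would contain a common zero over a further
    extension ([ext_isotropic3]). Hence [omega] vanishes nowhere
    ([regular_pf_vector]), and as soon as it does not vanish it spans the
    radical ([ker_pf_vector]).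

    The [w_l] are then linearly independent: the space of their linear
    relations is stable under a shift, and an eigenvector of the shift is a
    relation [(1, z, ..., z^m)], that is, a zero of [omega] ([coef_row_free]).
    The recurrence makes their span totally isotropic for both forms
    ([pencil_isotropic]). Vectors [u_j] dual to the functionals [b1 (w_j, -)]
    complete the basis, and adding combinations of the [w_l] to them makes
    their span totally isotropic too ([antidiag_solution], [kronecker_form]).
    Finally the half-discriminant is [(q0 + t q1) (omega (t))], which by
    isotropy of the [w_l] is the sum of the
    [q0 (w_l) t^(2 l) + q1 (w_l) t^(2 l + 1)].

    In characteristic 2 the signs in Pfaffians are irrelevant, so Pfaffians are
    handled as hafnians of lists of indices. Forms on [E] are handled through
    coordinates, as [x |-> x G x^T] for a matrix [G]. *)

(** * Hafnians of lists of indices *)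

(** All ways to take one entry out of a list, by position, so that repeated
    entries are taken separately. *)
Fixpoint picks (T : Type) (s : seq T) : seq (T * seq T) :=
  if s is x :: s' then (x, s') :: [seq (p.1, x :: p.2) | p <- picks s']
  else [::].

(** The list of indices selects rows and columns, so that these may be
    permuted, repeated or dropped without casts between matrix sizes. [k] is
    the number of pairs, and the value is 0 unless the list has length
    [2 k]. *)
Fixpoint haf (R : nzRingType) (T : Type) (A : T -> T -> R) (k : nat)
    (s : seq T) : R :=
  match k with
  | 0 => (nilp s)%:R
  | k'.+1 => if s is x :: s' then
               \sum_(p <- picks s') A x p.1 * haf A k' p.2
             else 0
  end.

Lemma picks_uniq (T : eqType) (s : seq T) :
  uniq s -> picks s = [seq (y, rem y s) | y <- s].
Proof.
elim: s => //= x s IHs /andP[xs us]; rewrite eqxx IHs //; congr cons.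
rewrite -map_comp; apply/eq_in_map => y ys /=.
by case: eqP => // xy; rewrite xy ys in xs.
Qed.

Lemma sum_picks_cons (R : nmodType) (T : Type) (h : T -> seq T -> R) x s :
  \sum_(p <- picks (x :: s)) h p.1 p.2 =
  h x s + \sum_(p <- picks s) h p.1 (x :: p.2).
Proof. by rewrite /= big_cons big_map. Qed.

Lemma sum_picks2_cons (R : nmodType) (T : Type) (h : T -> T -> seq T -> R) x s :
  \sum_(p <- picks (x :: s)) \sum_(r <- picks p.2) h p.1 r.1 r.2 =
  \sum_(p <- picks s) h x p.1 p.2 + \sum_(p <- picks s) h p.1 x p.2 +
  \sum_(p <- picks s) \sum_(r <- picks p.2) h p.1 r.1 (x :: r.2).
Proof.
rewrite (sum_picks_cons (fun y s' => \sum_(r <- picks s') h y r.1 r.2)).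
rewrite -[RHS]addrA; congr (_ + _); rewrite -big_split; apply: eq_bigr => p _.
by rewrite (sum_picks_cons (h p.1)).
Qed.

Lemma sum_picks2C (R : nmodType) (T : Type) (h : T -> T -> seq T -> R) s :
  \sum_(p <- picks s) \sum_(r <- picks p.2) h p.1 r.1 r.2 =
  \sum_(p <- picks s) \sum_(r <- picks p.2) h r.1 p.1 r.2.
Proof.
elim: s h => [|x s IHs] h; first by rewrite !big_nil.
rewrite sum_picks2_cons (sum_picks2_cons (fun y z => h z y)).
by rewrite (IHs (fun y z s' => h y z (x :: s'))) (addrC (\sum_(p <- _) h x _ _)).
Qed.

(** Every unordered pair of positions is met in both orders. *)
Lemma sum_picks2_sym (R : nzRingType) (T : Type) (h : T -> T -> seq T -> R) s :
    2%N \in [pchar R] -> (forall y z s', h y z s' = h z y s') ->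
  \sum_(p <- picks s) \sum_(r <- picks p.2) h p.1 r.1 r.2 = 0.
Proof.
move=> R2; elim: s h => [|x s IHs] h hC; first by rewrite big_nil.
rewrite sum_picks2_cons (IHs (fun y z s' => h y z (x :: s'))) //.
by rewrite addr0 (eq_bigr _ (fun p _ => hC x p.1 p.2)) addrr_pchar2.
Qed.

Lemma sum_picks_perm (R : nmodType) (T : Type) (h : T -> seq T -> R) s t :
    (forall y s' t', Permutation s' t' -> h y s' = h y t') ->
  Permutation s t ->
  \sum_(p <- picks s) h p.1 p.2 = \sum_(p <- picks t) h p.1 p.2.
Proof.
move=> hP st; elim: st h hP => {s t} [|x s t st IH|x y s|s t u st IHt tu IHu] h hP //.
- rewrite !sum_picks_cons (hP x _ _ st); congr (_ + _).
  by apply: (IH (fun z s' => h z (x :: s'))) => z s' t' st'; apply/hP/perm_skip.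
- rewrite !sum_picks_cons (sum_picks_cons (fun z s' => h z (y :: s'))).
  rewrite (sum_picks_cons (fun z s' => h z (x :: s'))) !addrA.
  rewrite (addrC (h y _)); congr (_ + _); apply: eq_bigr => p _.
  exact/hP/perm_swap.
- by rewrite (IHt h hP) (IHu h hP).
Qed.

Lemma perm_eq_Permutation (T : eqType) (s t : seq T) :
  perm_eq s t -> Permutation s t.
Proof.
elim: s t => [|x s IHs] t st; first by move: st; rewrite perm_sym => /perm_nilP ->.
have /splitPr tE : x \in t by rewrite -(perm_mem st) mem_head.
case: tE st => t1 t2 st; apply: Permutation_cons_app; apply: IHs.
by rewrite -(perm_cons x) (permPl st) (perm_catCA t1 [:: x]).
Qed.

Section HafnianTheory.

Variables (R : comNzRingType) (R2 : 2%N \in [pchar R]).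
Variables (T : Type) (A : T -> T -> R).
Hypothesis symA : forall i j, A i j = A j i.

(** Expand along both [x] and [y]: either they are paired with each other, or
    their partners form an ordered pair of positions of [s]. *)
Lemma haf_swap k x y s : haf A k (x :: y :: s) = haf A k (y :: x :: s).
Proof.
case: k => [|k] //=; rewrite !big_cons !big_map /= (symA x y); congr (_ + _).
case: k => [|k] /=; first by rewrite !big1 // => p _; rewrite mulr0.
pose h z w s' := A x z * A y w * haf A k s'.
transitivity (\sum_(p <- picks s) \sum_(r <- picks p.2) h p.1 r.1 r.2).
  apply: eq_bigr => p _; rewrite mulr_sumr; apply: eq_bigr => r _.
  by rewrite mulrA.
rewrite sum_picks2C; apply: eq_bigr => p _; rewrite mulr_sumr.
by apply: eq_bigr => r _; rewrite mulrA (mulrC (A y _)).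
Qed.

Lemma haf_Permutation k s t : Permutation s t -> haf A k s = haf A k t.
Proof.
elim: k s t => [|k IHk] s t st.
  by have := Permutation_length st; case: s {st} => [|x s]; case: t.
elim: st => {s t} [|x s t st _|x y s|s t u _ -> _ ->] //; last exact: haf_swap.
apply: (sum_picks_perm (h := fun y s' => A x y * haf A k s')) st.
by move=> y s' t' st; rewrite (IHk s' t').
Qed.

Hypothesis altA : forall i, A i i = 0.

(** Two distinct partners of the two copies of a repeated index may be
    exchanged, so the matchings cancel in pairs. *)
Lemma haf_repeat k x s : haf A k (x :: x :: s) = 0.
Proof.
case: k => [|k] //=; rewrite big_cons big_map /= altA mul0r add0r.
case: k => [|k] /=; first by rewrite big1 // => p _; rewrite mulr0.
under eq_bigr => p _ do rewrite mulr_sumr.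
under eq_bigr => p _ do under eq_bigr => r _ do rewrite mulrA.
apply: (sum_picks2_sym (h := fun z w s' => A x z * A x w * haf A k s')) => //.
by move=> y z s'; rewrite (mulrC (A x y)).
Qed.

End HafnianTheory.

Section HafnianEq.

Variables (R : comNzRingType) (R2 : 2%N \in [pchar R]).
Variables (T : eqType) (A : T -> T -> R).
Hypothesis symA : forall i j, A i j = A j i.
Hypothesis altA : forall i, A i i = 0.

Lemma haf_perm k s t : perm_eq s t -> haf A k s = haf A k t.
Proof. by move/perm_eq_Permutation; apply: haf_Permutation. Qed.

Lemma haf_mem k x s : x \in s -> haf A k (x :: s) = 0.
Proof.
move=> xs; rewrite (@haf_perm k _ (x :: x :: rem x s)) ?haf_repeat //.
by rewrite perm_cons perm_to_rem.
Qed.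

Lemma haf_not_uniq k s : ~~ uniq s -> haf A k s = 0.
Proof.
move=> nus; have [x [t st]] : exists x t, perm_eq s (x :: x :: t).
  elim: s nus => //= x s IHs; rewrite negb_and negbK.
  case: (boolP (x \in s)) => [xs _ | _ /= /IHs [y [t st]]].
    by exists x, (rem x s); rewrite perm_cons perm_to_rem.
  exists y, (x :: t); apply: (@perm_trans _ [:: x, y, y & t]).
    by rewrite perm_cons.
  by rewrite (perm_catCA [:: x] [:: y; y]).
by rewrite (haf_perm _ st) haf_repeat.
Qed.

Lemma haf_cons k x s : uniq s ->
  haf A k.+1 (x :: s) = \sum_(y <- s) A x y * haf A k (rem y s).
Proof. by move=> us; rewrite /= picks_uniq // big_map. Qed.

End HafnianEq.

(** * The vector of sub-Pfaffians of an alternating matrix of odd size *)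

Lemma perm_rem_enum n (j : 'I_n.+1) :
  perm_eq (rem j (enum 'I_n.+1)) [seq lift j i | i <- enum 'I_n].
Proof.
apply: uniq_perm; first exact/rem_uniq/enum_uniq.
  by rewrite map_inj_uniq ?enum_uniq //; apply: lift_inj.
move=> i; rewrite mem_rem_uniq ?enum_uniq // inE mem_enum andbT.
apply/idP/mapP => [|[k _ ->]]; last by rewrite eq_sym neq_lift.
by case: (unliftP j i) => [k -> _ | -> /eqP //]; exists k; rewrite ?mem_enum.
Qed.

Lemma picks_map (T U : Type) (f : T -> U) (s : seq T) :
  picks [seq f i | i <- s] = [seq (f p.1, map f p.2) | p <- picks s].
Proof. by elim: s => //= x s ->; rewrite -!map_comp. Qed.

Lemma pfaffian_haf (R : comNzRingType) (T : eqType) (A : T -> T -> R) d k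
    (f : 'I_d -> T) :
    2%N \in [pchar R] -> (forall i j, A i j = A j i) -> d = k.*2 ->
  pfaffian (\matrix_(i, j) A (f i) (f j)) = haf A k [seq f i | i <- enum 'I_d].
Proof.
move=> R2 symA; elim: k d f => [|k IHk] d f dk.
  by rewrite {d}dk in f *; rewrite enum_ord0.
case: d dk f => [//|[//|d]] [dk] f.
rewrite enum_ordSl map_cons -map_comp [RHS]/= picks_map big_map.
rewrite picks_uniq ?enum_uniq // big_map big_enum /=; apply: eq_bigr => j _.
have -> : (-1 : R) ^+ j = 1 by rewrite oppr_pchar2 ?expr1n.
rewrite mul1r mxE; congr (_ * _).
rewrite (haf_perm symA k (perm_map (f \o lift ord0) (perm_rem_enum j))).
rewrite -map_comp -(IHk d) //; congr pfaffian.
by apply/matrixP => a b; rewrite !mxE.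
Qed.

Lemma rmorph_haf (R S : nzRingType) (g : {rmorphism R -> S}) (T : Type)
    (A : T -> T -> R) (B : T -> T -> S) k s :
  (forall i j, B i j = g (A i j)) -> haf B k s = g (haf A k s).
Proof.
move=> AB; elim: k s => [|k IHk] [|x s] /=; rewrite ?rmorph1 ?rmorph0 //.
by rewrite rmorph_sum; apply: eq_bigr => p _; rewrite rmorphM AB IHk.
Qed.

(** Its entry at [j] is the Pfaffian of [A] with the [j]-th row and column
    deleted, see [pf_vectorE]. *)
Definition pf_vector (R : nzRingType) (m : nat) (A : 'M[R]_((2 * m).+1)) :
    'rV[R]_((2 * m).+1) :=
  \row_j haf A m (rem j (enum 'I_(2 * m).+1)).

Lemma map_pf_vector (R S : nzRingType) (g : {rmorphism R -> S}) m
    (A : 'M[R]_((2 * m).+1)) :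
  pf_vector (map_mx g A) = map_mx g (pf_vector A).
Proof.
apply/rowP => j; rewrite !mxE; apply: rmorph_haf => i k.
by rewrite mxE.
Qed.

Section PfVector.

Variables (R : comNzRingType) (R2 : 2%N \in [pchar R]) (m : nat).
Variable A : 'M[R]_((2 * m).+1).
Hypothesis symA : forall i j, A i j = A j i.
Hypothesis altA : forall i, A i i = 0.

Lemma pf_vectorE j : pf_vector A 0 j = pfaffian (row' j (col' j A)).
Proof.
have -> : row' j (col' j A) = \matrix_(a, b) A (lift j a) (lift j b).
  by apply/matrixP => a b; rewrite !mxE.
rewrite (@pfaffian_haf _ _ A _ m) //; last by rewrite mul2n.
by rewrite mxE; apply/haf_perm/perm_rem_enum.
Qed.

(** Each entry of the product is the expansion along its first row of the
    hafnian of a matrix with a repeated row. *)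
Lemma pf_vector_ker : pf_vector A *m A = 0.
Proof.
apply/rowP => i; rewrite !mxE.
have := haf_mem R2 symA altA m.+1 (mem_enum 'I_(2 * m).+1 i).
rewrite haf_cons ?enum_uniq // big_enum /= => {2}<-.
by apply: eq_bigr => j _; rewrite mxE mulrC symA.
Qed.

(** With [j] and [k] removed from the full list, put back a variable index [i]
    and sum against a kernel vector [x]: only the terms [i = j] and [i = k]
    survive, all others having a repeated index. *)
Lemma ker_pf_vector (x : 'rV[R]_((2 * m).+1)) j k : x *m A = 0 ->
  x 0 k * pf_vector A 0 j = x 0 j * pf_vector A 0 k.
Proof.
move=> xA; have [-> // | kj] := eqVneq k j.
have xA0 l : \sum_i x 0 i * A i l = 0.
  by have := congr1 (fun v : 'rV_ _ => v 0 l) xA; rewrite !mxE.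
pose s := rem j (enum 'I_(2 * m).+1); pose s1 := rem k s.
have us : uniq s by apply/rem_uniq/enum_uniq.
have us1 : uniq s1 by apply/rem_uniq.
have ks : k \in s by rewrite mem_rem_uniq ?enum_uniq // !inE kj mem_enum.
have pk : perm_eq (k :: s1) s by rewrite perm_sym perm_to_rem.
have pj : perm_eq (j :: s1) (rem k (enum 'I_(2 * m).+1)).
  apply: uniq_perm => [|| i] /=; rewrite ?us1 ?rem_uniq ?enum_uniq ?andbT //.
    by rewrite mem_rem_uniq // inE mem_rem_uniqF ?enum_uniq // andbF.
  rewrite inE [in LHS]mem_rem_uniq // inE mem_rem_uniq ?enum_uniq // inE mem_enum andbT.
  rewrite mem_rem_uniq ?enum_uniq // inE mem_enum andbT.
  by case: eqP => [->|_] /=; rewrite ?andbT // eq_sym kj.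
have: \sum_i x 0 i * haf A m (i :: s1) = 0.
  case: (posnP m) => [m0 | m_gt0].
    by have := ltn_ord k; have := ltn_ord j; move: kj; rewrite -val_eqE /=; lia.
  have hafE i : haf A m (i :: s1) = haf A m.-1.+1 (i :: s1) by rewrite prednK.
  under eq_bigr => i _ do rewrite hafE haf_cons // mulr_sumr.
  rewrite exchange_big big1 // => l _ /=.
  under eq_bigr => i _ do rewrite mulrA.
  by rewrite -mulr_suml xA0 mul0r.
rewrite (bigD1 k) //= (bigD1 j) 1?eq_sym //= big1 => [|i /andP[ik ij]]; last first.
  rewrite haf_mem ?mulr0 // mem_rem_uniq // inE ik.
  by rewrite mem_rem_uniq ?enum_uniq // inE ij mem_enum.
rewrite addr0 (haf_perm symA _ pk) (haf_perm symA _ pj) !mxE => /eqP.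
by rewrite addr_eq0 oppr_pchar2 // => /eqP.
Qed.

End PfVector.

(** If all sub-Pfaffians of order [2 m] vanish, take the longest list [s] with
    nonzero hafnian: it misses at least three indices [y], and expanding the
    vanishing hafnians of the lists [i :: y :: s] exhibits for each of them a
    kernel vector supported on [y :: s] with a nonzero entry at [y]. *)
Lemma pf_vector_eq0 (K : fieldType) (m : nat) (A : 'M[K]_((2 * m).+1)) :
    2%N \in [pchar K] -> (forall i j, A i j = A j i) -> (forall i, A i i = 0) ->
    pf_vector A = 0 ->
  exists2 V : 'M[K]_(3, (2 * m).+1), row_free V & V *m A = 0.
Proof.
move=> K2 symA altA A0.
pose P k := [exists s : k.*2.-tuple 'I_(2 * m).+1, haf A k s != 0].
(* Uniqueness may be assumed, and a list of [2 m] distinct indices is a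
   permutation of the full list with one index removed. *)
have nPm : ~~ P m.
  apply/existsPn => s; rewrite negbK.
  case: (boolP (uniq s)) => us; last by rewrite haf_not_uniq.
  have [j js] : exists j, j \notin s.
    apply/existsP; rewrite -negb_forall; apply/negP => /forallP sT.
    have: (size (enum 'I_(2 * m).+1) <= size s)%N.
      by apply: uniq_leq_size => [|i _]; [apply: enum_uniq | apply: sT].
    by rewrite size_enum_ord size_tuple; lia.
  have ujs : uniq (j :: s) by rewrite /= js.
  have [|_ jsE] := uniq_min_size ujs (fun i _ => mem_enum 'I_(2 * m).+1 i).
    by rewrite size_enum_ord /= size_tuple; lia.
  have js_enum : perm_eq (j :: s) (enum 'I_(2 * m).+1).
    by apply: uniq_perm; rewrite ?enum_uniq.
  have s_rem : perm_eq s (rem j (enum 'I_(2 * m).+1)).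
    by rewrite -(perm_cons j) (perm_trans js_enum) // perm_to_rem ?mem_enum.
  have := congr1 (fun v : 'rV_ _ => v 0 j) A0; rewrite !mxE => hj.
  by rewrite (haf_perm symA _ s_rem) hj.
have [k [k_lt /existsP[s hs] nPk]] :
    exists k, [/\ (k < m)%N, P k & ~~ P k.+1].
  have exnP : exists k, ~~ P k by exists m.
  case: (ex_minnP exnP) => -[|k] nPk kmin.
    by case/existsP: nPk; exists [tuple]; rewrite /= oner_eq0.
  exists k; split; [exact: kmin | | by []].
  by apply: contraT => /kmin; rewrite ltnn.
have us : uniq s by apply: contraR hs => nus; rewrite haf_not_uniq.
have hk1 (t : seq _) : size t = k.+1.*2 -> haf A k.+1 t = 0.
  move=> /eqP t_k; apply/eqP; move/existsPn: nPk => /(_ (Tuple t_k)).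
  by rewrite negbK.
pose c := enum [predC s].
have c_size : (3 <= size c)%N.
  rewrite -cardE -(leq_add2l k.*2); have := cardC (mem s).
  by rewrite (card_uniqP us) card_ord size_tuple => ->; lia.
pose x (a : 'I_3) := nth ord0 c a.
have x_inj : injective x.
  move=> a b /eqP; rewrite nth_uniq ?enum_uniq //; first by move/eqP/val_inj.
    exact: leq_trans (ltn_ord a) c_size.
  exact: leq_trans (ltn_ord b) c_size.
have xs a : x a \notin s.
  have := mem_nth ord0 (leq_trans (ltn_ord a) c_size).
  by rewrite mem_enum inE.
pose v y j := if j \in y :: s then haf A k (rem j (y :: s)) else 0.
exists (\matrix_(a, j) v (x a) j).
  apply/row_freeP.
  exists (\matrix_(j, b) ((j == x b)%:R / haf A k s)).
  apply/matrixP => a b; rewrite !mxE (bigD1 (x b)) //= big1 => [|j jb]; last first.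
    by rewrite !mxE (negPf jb) mul0r mulr0.
  rewrite !mxE eqxx addr0 /v inE (inj_eq x_inj) (negPf (xs b)) orbF /=.
  have [-> | _] := eqVneq b a; first by rewrite !eqxx mul1r mulfV.
  by rewrite mul0r.
apply/matrixP => a i; rewrite !mxE.
rewrite -[RHS](hk1 [:: i, x a & s]) ?haf_cons /= ?xs ?size_tuple //.
rewrite -[RHS]/(\sum_(y <- x a :: s) A i y * haf A k (rem y (x a :: s))).
rewrite [RHS]big_uniq ?[RHS]big_mkcond /= ?xs //; apply: eq_bigr => j _.
by rewrite !mxE /v; case: ifP => _; rewrite ?mul0r // mulrC symA.
Qed.

(** Each of the [k] factors of a term contributes at most one [X]. Applied to
    sub-Pfaffians, this identifies the top coefficient of the vector of
    sub-Pfaffians with the one of the member at infinity of the pencil. *)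
Lemma haf_pencil (R : comNzRingType) (T : Type) (A : T -> T -> {poly R})
    (B0 B1 : T -> T -> R) k s :
    (forall i j, A i j = (B0 i j)%:P + B1 i j *: 'X) ->
  (size (haf A k s) <= k.+1)%N /\ (haf A k s)`_k = haf B1 k s.
Proof.
move=> AE; elim: k s => [|k IHk] [|x s] /=; rewrite ?size_poly1 ?size_poly0 ?coefC //.
split.
  apply: (big_ind (fun p : {poly R} => size p <= k.+2)%N) => [|p q hp hq|p _].
  - by rewrite size_poly0.
  - by rewrite (leq_trans (size_polyD _ _)) // geq_max hp.
  - rewrite AE mulrDl mul_polyC -scalerAl mulrC.
    apply: leq_trans (size_polyD _ _) _; rewrite geq_max; apply/andP; split.
      by apply: leq_trans (size_scale_leq _ _) _; apply: leqW (IHk _).1.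
    apply: leq_trans (size_scale_leq _ _) (leq_trans (size_polyMleq _ _) _).
    by rewrite size_polyX addn2 /= ltnS (IHk _).1.
rewrite coef_sum; apply: eq_bigr => p _; rewrite AE mulrDl mul_polyC -scalerAl.
rewrite coefD !coefZ coefXM /= (IHk _).2.
by rewrite nth_default ?(IHk _).1 // mulr0 add0r.
Qed.

(** * Field extensions *)

(** An irreducible factor of [p] exists by classical reasoning and induction on
    the size. *)
Lemma ext_root (K : fieldType) (p : {poly K}) : (1 < size p)%N ->
  exists (L : fieldType) (j : {rmorphism K -> L}) (z : L),
    root (map_poly j p) z.
Proof.
have [n] := ubnP (size p); elim: n p => // n IHn p /ltnSE p_n p_gt1.
have [irr_p | red_p] := classic (irreducible_poly p).
  have [L _ [z pz _]] := irredp_FAdjoin irr_p.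
  by exists L, (in_alg L), z.
have [q [q_neq1 qp q_neqp]] :
    exists q : {poly K}, [/\ size q != 1%N, q %| p & ~~ (q %= p)].
  apply: NNPP => no_q; apply: red_p; split=> // q q_neq1 qp.
  by apply: contraT => q_neqp; case: no_q; exists q.
have p0 : p != 0 by rewrite -size_poly_gt0 ltnW.
have q0 : q != 0 by apply: contraNneq p0 => q0; rewrite q0 dvd0p in qp.
have q_lt : (size q < size p)%N.
  by rewrite ltn_neqAle dvdp_leq // andbT dvdp_size_eqp.
have [| | L [j [z qz]]] := IHn q.
- exact: leq_trans q_lt p_n.
- by move: q_neq1; rewrite -size_poly_gt0 in q0; case: size q0 => [|[]].
- exists L, j, z; case/dvdpP: qp => r ->.
  by rewrite rmorphM rootM qz orbT.
Qed.

Lemma ext_roots (K : fieldType) (ps : seq {poly K}) :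
    {in ps, forall p : {poly K}, (1 < size p)%N} ->
  exists (L : fieldType) (j : {rmorphism K -> L}),
    {in ps, forall p : {poly K}, exists z, root (map_poly j p) z}.
Proof.
elim: ps => [|p ps IHps] p_gt1; first by exists K, idfun.
have [q qps | L [j jP]] := IHps; first by apply: p_gt1; rewrite inE qps orbT.
have [|L' [j' [z pz]]] := @ext_root L (map_poly j p).
  by rewrite size_map_poly p_gt1 ?mem_head.
exists L', (j' \o j) => q; rewrite inE => /predU1P[-> | /jP [y qy]].
  by exists z; rewrite map_poly_comp.
by exists (j' y); rewrite map_poly_comp fmorph_root.
Qed.

(** * Quadratic forms given by Gram matrices *)

(** [G] is a Gram matrix in the quadratic sense: the form is
    [x |-> x G x^T] and its polar form has matrix [G + G^T], so that [G] may
    be taken triangular. *)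
Definition gram_value (R : nzRingType) (n : nat) (G : 'M[R]_n) (x : 'rV[R]_n) : R :=
  (x *m G *m x^T) 0 0.

Definition gram_polar (R : nzRingType) (n : nat) (G : 'M[R]_n) : 'M[R]_n :=
  G + G^T.

Lemma gram_polar_sym (R : nzRingType) n (G : 'M[R]_n) i j :
  gram_polar G i j = gram_polar G j i.
Proof. by rewrite !mxE addrC. Qed.

Lemma gram_polar_alt (R : nzRingType) n (G : 'M[R]_n) i :
  2%N \in [pchar R] -> gram_polar G i i = 0.
Proof. by move=> R2; rewrite !mxE addrr_pchar2. Qed.

Lemma gram_value_comb (R : comNzRingType) k n (G : 'M[R]_n) (V : 'M[R]_(k, n)) y :
  gram_value G (y *m V) = gram_value (V *m G *m V^T) y.
Proof. by rewrite /gram_value trmx_mul !mulmxA. Qed.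

Lemma gram_valueE (R : comNzRingType) n (G : 'M[R]_n) x :
  gram_value G x = \sum_i \sum_j G i j * (x 0 i * x 0 j).
Proof.
rewrite /gram_value mxE exchange_big; apply: eq_bigr => j _.
rewrite !mxE mulr_suml; apply: eq_bigr => i _.
by rewrite mulrAC mulrC.
Qed.

(** In characteristic 2 the two off-diagonal terms of a symmetric matrix
    cancel. *)
Lemma gram_value_sym (R : comNzRingType) n (S : 'M[R]_n) x :
    2%N \in [pchar R] -> (forall i j, S i j = S j i) ->
  gram_value S x = \sum_i S i i * x 0 i ^+ 2.
Proof.
move=> R2 symS; rewrite gram_valueE.
transitivity (\sum_i (S i i * x 0 i ^+ 2 + \sum_(j | j != i) S i j * (x 0 i * x 0 j))).
  by apply: eq_bigr => i _; rewrite (bigD1 i).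
rewrite big_split /= [X in _ + X](_ : _ = 0) ?addr0 //.
rewrite pair_big_dep /= (bigID (fun p : 'I_n * 'I_n => p.1 < p.2)%N) /=.
rewrite (reindex_inj (h := fun p : 'I_n * 'I_n => (p.2, p.1))) /=; last first.
  by move=> [a b] [c d] [-> ->].
rewrite [X in X + _](_ : _ = \sum_(p : 'I_n * 'I_n | (p.2 != p.1) && ~~ (p.1 < p.2)%N)
   S p.1 p.2 * (x 0 p.1 * x 0 p.2)) ?addrr_pchar2 //.
apply: eq_big => [[a b]|[a b] _] /=; last by rewrite symS (mulrC (x 0 a)).
by rewrite -leqNgt ltn_neqAle eq_sym -val_eqE; case: eqP.
Qed.

Lemma map_gram_value (R S : comNzRingType) (g : {rmorphism R -> S}) n
    (G : 'M[R]_n) x :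
  gram_value (map_mx g G) (map_mx g x) = g (gram_value G x).
Proof. by rewrite /gram_value map_trmx -!map_mxM mxE. Qed.

(** What the Jacobian criterion says of a smooth complete intersection of the
    two quadrics, since the differential of a quadratic form at [x] is its
    polar form with [x]. *)
Definition pencil_regular (F : fieldType) (n : nat) (G0 G1 : 'M[F]_n) : Prop :=
  forall (K : fieldType) (iota : {rmorphism F -> K}) (x : 'rV[K]_n) (s t : K),
    x != 0 -> gram_value (map_mx iota G0) x = 0 ->
    gram_value (map_mx iota G1) x = 0 ->
    x *m gram_polar (s *: map_mx iota G0 + t *: map_mx iota G1) = 0 ->
  s = 0 /\ t = 0.

Lemma pencil_regular_map (F K : fieldType) (iota : {rmorphism F -> K}) n
    (G0 G1 : 'M[F]_n) :
  pencil_regular G0 G1 -> pencil_regular (map_mx iota G0) (map_mx iota G1).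
Proof.
move=> reg L j x s t; rewrite -!map_mx_comp => x0 x_0 x_1 xst.
exact: (reg L (j \o iota) x s t).
Qed.

(** Unless [(1, 0)] is already a zero, dehomogenizing gives a nonconstant
    polynomial in one variable. *)
Lemma ext_isotropic2 (K : fieldType) n (G : 'M[K]_n) (W : 'M[K]_(2, n)) :
  exists (L : fieldType) (j : {rmorphism K -> L}) (y : 'rV[L]_2),
    y != 0 /\ gram_value (map_mx j G) (y *m map_mx j W) = 0.
Proof.
pose S := W *m G *m W^T.
have SE (L : fieldType) (j : {rmorphism K -> L}) y :
    gram_value (map_mx j G) (y *m map_mx j W) =
    j (S 0 0) * y 0 0 ^+ 2 + j (S 0 1 + S 1 0) * (y 0 0 * y 0 1) +
    j (S 1 1) * y 0 1 ^+ 2.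
  rewrite gram_value_comb map_trmx -!map_mxM gram_valueE -/S; move: (S) => T.
  have -> : 1 = lift ord0 ord0 :> 'I_2 by apply: val_inj.
  by rewrite !big_ord_recl !big_ord0 !addr0 !mxE rmorphD; ring.
have [S00 | S00] := eqVneq (S 0 0) 0.
  pose y : 'rV[K]_2 := \row_i (i == 0)%:R.
  have y1 : y 0 1 = 0 by rewrite mxE.
  exists K, idfun, y; split; last by rewrite SE /= S00 y1; ring.
  by apply/eqP => /rowP/(_ 0) /eqP; rewrite !mxE oner_eq0.
pose p := S 0 0 *: 'X^2 + (S 0 1 + S 1 0) *: 'X + (S 1 1)%:P.
have p_size : (1 < size p)%N.
  rewrite ltnNge; apply/negP => /leq_sizeP/(_ 2 isT) /eqP.
  by rewrite !coefD !coefZ coefXn coefX coefC mulr0 mulr1 !addr0 (negPf S00).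
have [L [j [z pz]]] := ext_root p_size.
pose y : 'rV[L]_2 := \row_i (if i == 0 then z else 1).
have [y0 y1] : y 0 0 = z /\ y 0 1 = 1 by rewrite !mxE.
exists L, j, y; split.
  by apply/eqP => /rowP/(_ 1) /eqP; rewrite y1 mxE oner_eq0.
rewrite SE y0 y1 mulr1 expr1n mulr1; move/eqP: pz => <-.
by rewrite /p !rmorphD /= !map_polyZ map_polyC map_polyX map_polyXn !hornerE rmorphD.
Qed.

(** On the radical of its polar form, a quadratic form is additive, hence the
    square of a linear form over an extension that contains the square roots
    of its values on a basis. If the radical has dimension at least 3, this
    linear form vanishes on a plane, where the other form has a nontrivial
    zero over a further quadratic extension. *)
Lemma ext_isotropic3 (K : fieldType) n (G H : 'M[K]_n) (V : 'M[K]_(3, n)) :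
    2%N \in [pchar K] -> row_free V -> V *m gram_polar G = 0 ->
  exists (L : fieldType) (j : {rmorphism K -> L}) (x : 'rV[L]_n),
    [/\ x != 0, gram_value (map_mx j G) x = 0, gram_value (map_mx j H) x = 0
      & x *m map_mx j (gram_polar G) = 0].
Proof.
move=> K2 Vfree VG; pose S := V *m G *m V^T.
have symS i j : S i j = S j i.
  have : S + S^T = 0.
    by rewrite !trmx_mul trmxK mulmxA -mulmxDl -mulmxDr VG mul0mx.
  move: (S) => T /matrixP/(_ i j)/eqP; rewrite !mxE addr_eq0 oppr_pchar2 //.
  by move/eqP.
(* [beta i] is a square root of the value of the form at the [i]-th row of
   [V], and [M] spans a plane on which the linear form [beta] vanishes. *)
pose sq i : {poly K} := 'X^2 - (S i i)%:P.
have [_ /mapP[i _ ->] | L [j sqr]] := @ext_roots K [seq sq i | i <- enum 'I_3].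
  by rewrite size_XnsubC.
have /fin_all_exists [beta betaP] : forall i : 'I_3, exists b, b ^+ 2 = j (S i i).
  move=> i; have [|b sqb] := sqr (sq i); first by rewrite map_f ?mem_enum.
  exists b; apply/eqP; rewrite -subr_eq0; move/eqP: sqb.
  by rewrite /sq rmorphB /= map_polyXn map_polyC !hornerE => ->.
have L2 := rmorph_pchar j K2.
pose b := \col_i beta i; pose D := kermx b.
have rD : (2 <= \rank D)%N by rewrite mxrank_ker; have := rank_leq_col b; lia.
pose M : 'M[L]_(2, 3) := pid_mx 2 *m row_base D.
have Mb : M *m b = 0.
  apply/eqP; rewrite -sub_kermx; apply: submx_trans (submxMl _ _) _.
  by rewrite eq_row_base.
pose W := M *m map_mx j V.
have Wfree : row_free W.
  rewrite /row_free mxrankMfree ?row_free_map // mxrankMfree ?row_base_free //.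
  by rewrite rank_pid_mx.
have [L' [j' [y [y0 yH]]]] := ext_isotropic2 (map_mx j H) W.
have jjE k (A : 'M[K]_(k, n)) : map_mx (j' \o j) A = map_mx j' (map_mx j A).
  exact: map_mx_comp.
exists L', (j' \o j), (y *m map_mx j' W); rewrite !jjE; split=> //.
- by rewrite mulmx_free_eq0 // row_free_map.
- have -> : y *m map_mx j' W = (y *m map_mx j' M) *m map_mx (j' \o j) V.
    by rewrite jjE -mulmxA -map_mxM.
  rewrite -jjE gram_value_comb map_trmx -!map_mxM -/S.
  have L'2 := rmorph_pchar j' L2.
  rewrite gram_value_sym // => [|a c]; last first.
    by rewrite [LHS]mxE [RHS]mxE symS.
  set u := y *m _.
  have -> : \sum_i map_mx (j' \o j) S i i * u 0 i ^+ 2 =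
            (\sum_i u 0 i * j' (beta i)) ^+ 2.
    rewrite -[RHS](pFrobenius_autE L'2) rmorph_sum; apply: eq_bigr => i _.
    rewrite rmorphM /= !pFrobenius_autE -rmorphXn betaP mulrC; congr (_ * _).
    by rewrite [LHS]mxE.
  have -> : \sum_i u 0 i * j' (beta i) = (u *m map_mx j' b) 0 0.
    by rewrite [RHS]mxE; apply: eq_bigr => i _; rewrite !mxE.
  by rewrite /u -mulmxA -map_mxM Mb map_mx0 mulmx0 mxE expr0n.
- by rewrite -!mulmxA -!map_mxM -mulmxA -map_mxM VG !(map_mx0, mulmx0).
Qed.

(** * The pencil of polar forms *)

Lemma gram_valueD (R : comNzRingType) n (a b : R) (G H : 'M[R]_n) x :
  gram_value (a *: G + b *: H) x = a * gram_value G x + b * gram_value H x.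
Proof.
by rewrite /gram_value mulmxDr mulmxDl -!scalemxAr -!scalemxAl !mxE.
Qed.

Lemma map_gram_polar (R S : nzRingType) (g : {rmorphism R -> S}) n (G : 'M[R]_n) :
  map_mx g (gram_polar G) = gram_polar (map_mx g G).
Proof. by rewrite /gram_polar map_mxD map_trmx. Qed.

(** Otherwise the radical has dimension at least 3 and contains a zero of
    [s q0 + t q1] and of one more form of the pencil, hence a common zero of
    [q0] and [q1]. *)
Lemma regular_pf_vector (F K : fieldType) (iota : {rmorphism F -> K}) m
    (G0 G1 : 'M[F]_((2 * m).+1)) (s t : K) :
    2%N \in [pchar F] -> pencil_regular G0 G1 -> (s != 0) || (t != 0) ->
  pf_vector (gram_polar (s *: map_mx iota G0 + t *: map_mx iota G1)) != 0.
Proof.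
move=> F2 /(pencil_regular_map (iota := iota)) reg st; apply/eqP => A0.
have K2 := rmorph_pchar iota F2.
move: (map_mx iota G0) (map_mx iota G1) reg A0 => {G0 G1} G0 G1 reg A0.
have [V Vfree VA] := pf_vector_eq0 K2 (gram_polar_sym _)
  (fun i => gram_polar_alt _ i K2) A0.
pose H := if s != 0 then G1 else G0.
have [L [j [x [x0 xG xH xA]]]] := ext_isotropic3 H K2 Vfree VA.
have GE : map_mx j (s *: G0 + t *: G1) = j s *: map_mx j G0 + j t *: map_mx j G1.
  by rewrite map_mxD !map_mxZ.
have xG0 := xG; rewrite GE gram_valueD in xG0.
have [x_0 x_1] : gram_value (map_mx j G0) x = 0 /\ gram_value (map_mx j G1) x = 0.
  move: xH st xG0; rewrite /H; case: eqVneq => [-> /= -> t0|s0 -> _] /eqP.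
    by rewrite rmorph0 mul0r add0r mulf_eq0 fmorph_eq0 (negPf t0) => /eqP.
  by rewrite mulr0 addr0 mulf_eq0 fmorph_eq0 (negPf s0) => /eqP.
have [|/eqP s0 /eqP t0] := reg L j x (j s) (j t) x0 x_0 x_1.
  by rewrite -GE -map_gram_polar.
by move: st; rewrite !fmorph_eq0 in s0 t0; rewrite s0 t0.
Qed.

(** Equations along antidiagonals: [c i j + c j i = Q i j] pairs the entry
    [(i, j)] with [(j, i)], and [c i (j + 1) + c j (i + 1) = P i j] pairs
    [(i, j + 1)] with [(j, i + 1)]. On the entries with constant sum of indices
    these links form a path, so one may solve from the middle outwards;
    [antidiag d i] is the value of [c i (i + d)]. *)
Fixpoint antidiag (V : nmodType) (P Q : nat -> nat -> V) (d i : nat) : V :=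
  if d is d'.+2 then P i (i + d').+1 + Q i.+1 (i + d').+1 + antidiag P Q d' i.+1
  else 0.

Lemma antidiag_solution (R : nzRingType) (P Q : nat -> nat -> R) :
    2%N \in [pchar R] ->
    (forall i j, P i j = P j i) -> (forall i, P i i = 0) ->
    (forall i j, Q i j = Q j i) -> (forall i, Q i i = 0) ->
  exists c : nat -> nat -> R, forall i j,
    c i j + c j i = Q i j /\ c i j.+1 + c j i.+1 = P i j.
Proof.
move=> R2 symP altP symQ altQ; pose g := antidiag P Q.
pose c i k := if (i <= k)%N then g (k - i)%N i else g (i - k)%N k + Q i k.
have c_lt i d : c i (i + d)%N = g d i.
  by rewrite /c leq_addr addKn.
have c_gt i d : c (i + d)%N i = g d i + Q (i + d)%N i.
  case: d => [|d]; first by rewrite addn0 altQ addr0 -[i in c _ i]addn0 c_lt.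
  have -> : c (i + d.+1)%N i = g (i + d.+1 - i)%N i + Q (i + d.+1)%N i.
    by rewrite /c ifN // -ltnNge -addSnnS leq_addr.
  by rewrite addKn.
exists c.
suff c_le i d : c i (i + d)%N + c (i + d)%N i = Q i (i + d)%N /\
    c i (i + d).+1 + c (i + d)%N i.+1 = P i (i + d)%N.
  move=> i j; have [ij | /ltnW ji] := leqP i j; first by rewrite -(subnKC ij).
  by rewrite -(subnKC ji) addrC symQ [X in _ /\ X = _]addrC symP.
split; first by rewrite c_lt c_gt addrA addrr_pchar2 // add0r symQ.
case: d => [|d]; first by rewrite addn0 addrr_pchar2 // altP.
have -> : c i (i + d.+1).+1 = g d.+2 i by rewrite -addnS c_lt.
rewrite addnS -addSn c_gt addSn (symQ _ i.+1).
rewrite -[g d.+2 i]/(P i (i + d).+1 + Q i.+1 (i + d).+1 + g d i.+1) -!addrA.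
by rewrite [g _ _ + (g _ _ + _)]addrA addrr_pchar2 // add0r addrr_pchar2 // addr0.
Qed.

Section KroneckerForm.

Variables (F : fieldType) (F2 : 2%N \in [pchar F]) (m n : nat).
Variables (B0 B1 : 'M[F]_n) (w : nat -> 'rV[F]_n).

Hypothesis B0_sym : B0^T = B0.
Hypothesis B1_sym : B1^T = B1.
Hypothesis B0_alt : forall i, B0 i i = 0.
Hypothesis B1_alt : forall i, B1 i i = 0.
Hypothesis w_gt : forall l, (m < l)%N -> w l = 0.
Hypothesis w0_ker : w 0 *m B0 = 0.
Hypothesis wS_ker : forall l, w l.+1 *m B0 = w l *m B1.
Hypothesis ker_B1 : forall x : 'rV_n, x *m B1 = 0 -> exists c, x = c *: w m.
Hypothesis w_neq0 : forall (K : fieldType) (iota : {rmorphism F -> K}) (z : K),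
  \sum_(l < m.+1) z ^+ l *: map_mx iota (w l) != 0.

Let Omega : 'M[F]_(m.+1, n) := \matrix_(l < m.+1) w l.

(** Multiplying a relation between the [w l] by [B0], and using that the
    kernel of [B1] is spanned by [w m], shows that the space of relations is
    stable under the shift. An eigenvector of the shift over an extension is
    proportional to [(1, z, ..., z^m)], and is a relation that [w_neq0]
    excludes. *)
Lemma coef_row_free : row_free Omega.
Proof.
have mul_Omega (K : fieldType) (iota : {rmorphism F -> K}) (c : 'rV[K]_m.+1) :
    c *m map_mx iota Omega = \sum_(l < m.+1) c 0 l *: map_mx iota (w l).
  rewrite mulmx_sum_row; apply: eq_bigr => l _; congr (_ *: _).
  by rewrite -map_row rowK.
have mul_Omega1 (c : 'rV[F]_m.+1) : c *m Omega = \sum_(l < m.+1) c 0 l *: w l.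
  by rewrite mulmx_sum_row; apply: eq_bigr => l _; rewrite rowK.
rewrite -kermx_eq0; apply/negPn/negP => ker_neq0.
have [r [C [r_gt0 Cfree CE]]] : exists r (C : 'M[F]_(r, m.+1)),
    [/\ (0 < r)%N, row_free C & (C :=: kermx Omega)%MS].
  exists (\rank (kermx Omega)), (row_base (kermx Omega)).
  by rewrite row_base_free lt0n mxrank_eq0; split=> //; apply: eq_row_base.
have COmega : C *m Omega = 0 by apply/eqP; rewrite -sub_kermx CE.
(* Shift each relation to the left by one place: the new last coefficient
   [- lambda i] exists because [B1] only kills multiples of [w m]. *)
have /fin_all_exists [lambda shiftP] : forall i, exists c,
    \sum_(l < m) C i (lift ord0 l) *: w l = c *: w m.
  move=> i; apply: ker_B1; rewrite mulmx_suml.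
  transitivity (row i C *m Omega *m B0).
    rewrite mul_Omega1 mulmx_suml big_ord_recl /= -scalemxAl w0_ker scaler0 add0r.
    by apply: eq_bigr => l _; rewrite -!scalemxAl wS_ker mxE.
  by rewrite -row_mul COmega row0 mul0mx.
pose C' := \matrix_(i < r, l < m.+1)
  (if unlift ord_max l is Some l' then C i (lift ord0 l') else - lambda i).
have /submxP [T C'E] : (C' <= C)%MS.
  rewrite CE; apply/sub_kermxP/row_matrixP => i.
  rewrite row_mul row0 mul_Omega1 big_ord_recr /=.
  rewrite !mxE unlift_none scaleNr -shiftP; apply/eqP; rewrite subr_eq0; apply/eqP.
  apply: eq_bigr => l _; rewrite !mxE.
  have -> : widen_ord (leqnSn m) l = lift ord_max l.
    by apply/val_inj/esym/lift_max.
  by rewrite liftK.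
(* [T] is the matrix of the shift on the space of relations. *)
have [|L [j [z]]] := @ext_root F (char_poly T).
  by rewrite size_char_poly ltnS.
rewrite map_char_poly -eigenvalue_root_char => /eigenvalueP [v vT v0].
pose u := v *m map_mx j C.
have u0 : u != 0 by rewrite mulmx_free_eq0 // row_free_map.
have uOmega : u *m map_mx j Omega = 0 by rewrite -mulmxA -map_mxM COmega map_mx0 mulmx0.
have uS (l : 'I_m) : u 0 (lift ord0 l) = z * u 0 (lift ord_max l).
  transitivity ((z *: u) 0 (lift ord_max l)); last by rewrite mxE.
  rewrite /u scalemxAl -vT -mulmxA -map_mxM -C'E !mxE.
  by apply: eq_bigr => i _; rewrite !mxE liftK.
have uE (l : 'I_m.+1) : u 0 l = z ^+ l * u 0 0.
  case: l => l; elim: l => [|l IHl] l_lt.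
    by rewrite mul1r; congr (u _ _); apply: val_inj.
  have -> : Ordinal l_lt = lift ord0 (Ordinal (l_lt : l < m)%N) by apply: val_inj.
  rewrite uS /= exprS -mulrA -(IHl (ltnW l_lt)); congr (_ * u _ _).
  exact/val_inj/lift_max.
have u00 : u 0 0 != 0.
  by apply: contraNneq u0 => u00; apply/eqP/rowP => l; rewrite uE u00 mulr0 mxE.
have /eqP : u 0 0 *: (\sum_(l < m.+1) z ^+ l *: map_mx j (w l)) = 0.
  rewrite scaler_sumr -[RHS]uOmega mul_Omega; apply: eq_bigr => l _.
  by rewrite scalerA [u 0 l]uE mulrC.
by rewrite scaler_eq0 (negPf u00) (negPf (w_neq0 j z)).
Qed.

(** The recurrence moves a unit of index from one argument to the other, down
    to [w 0], which is in the kernel of [B0]. *)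
Lemma pencil_isotropic k l :
  w k *m B0 *m (w l)^T = 0 /\ w k *m B1 *m (w l)^T = 0.
Proof.
have symC (B : 'M[F]_n) (x y : 'rV[F]_n) : B^T = B -> x *m B *m y^T = y *m B *m x^T.
  have tr11 (M : 'M[F]_1) : M^T = M by apply/matrixP => i j; rewrite mxE !ord1.
  by move=> Bs; rewrite -[RHS]tr11 !trmx_mul trmxK Bs mulmxA.
have shift a b : w a.+1 *m B0 *m (w b)^T = w a *m B0 *m (w b.+1)^T.
  by rewrite wS_ker symC // -wS_ker symC.
have iso0 a b : w a *m B0 *m (w b)^T = 0.
  by elim: a b => [|a IHa] b; [rewrite w0_ker mul0mx | rewrite shift IHa].
by split; [|rewrite -wS_ker]; apply: iso0.
Qed.

Lemma bilinear_entry k l (A : 'M[F]_(k, n)) (B : 'M[F]_n) (C : 'M[F]_(l, n)) i j :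
  (A *m B *m C^T) i j = (row i A *m B *m (row j C)^T) 0 0.
Proof.
by rewrite -row_mul !mxE; apply: eq_bigr => a _; rewrite !mxE.
Qed.

Lemma Omega_isotropic : Omega *m B0 *m Omega^T = 0 /\ Omega *m B1 *m Omega^T = 0.
Proof.
by split; apply/matrixP => i j; rewrite bilinear_entry !rowK;
  have [iso0 iso1] := pencil_isotropic i j; rewrite ?iso0 ?iso1 !mxE.
Qed.

(** Rows [U0] dual to the functionals [w i *m B1] complete [Omega] to a basis.
    Replacing [U0] by [U0 + C Omega] does not affect this duality, and adds
    [D + D^T] to the matrix of either form on [U0], where [D i j] is [C i j]
    for [B1] and [C i (j + 1)] for [B0]; [antidiag_solution] provides the [C]
    that cancels both. *)
Lemma kronecker_form : exists U : 'M[F]_(m, n),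
  [/\ row_free (col_mx Omega U), U *m B0 *m U^T = 0, U *m B1 *m U^T = 0,
      forall k j, (Omega *m B0 *m U^T) k j = (k == j.+1 :> nat)%:R
    & forall k j, (Omega *m B1 *m U^T) k j = (k == j :> nat)%:R].
Proof.
have [iso0 iso1] := Omega_isotropic.
pose N : 'M[F]_(m, n) := \matrix_(i < m) (w i *m B1).
have Nfree : row_free N.
  apply: inj_row_free => v vN.
  have [|c vc] := ker_B1 (x := \sum_(l < m) v 0 l *: w l).
    rewrite mulmx_suml -[RHS]vN mulmx_sum_row; apply: eq_bigr => l _.
    by rewrite rowK scalemxAl.
  pose v' : 'rV[F]_m.+1 := \row_l (if unlift ord_max l is Some l' then v 0 l' else - c).
  have: v' *m Omega = 0.
    rewrite mulmx_sum_row big_ord_recr /= !rowK mxE unlift_none scaleNr -vc.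
    apply/eqP; rewrite subr_eq0; apply/eqP; apply: eq_bigr => l _.
    have -> : widen_ord (leqnSn m) l = lift ord_max l.
      by apply/val_inj/esym/lift_max.
    by rewrite rowK mxE liftK lift_max.
  move/eqP; rewrite mulmx_free_eq0 ?coef_row_free // => /eqP v'0.
  apply/rowP => l; have := congr1 (fun x : 'rV_ _ => x 0 (lift ord_max l)) v'0.
  by rewrite !mxE liftK.
have /row_freeP [U' NU'] := Nfree; pose U0 := U'^T.
have wB1 k (j : 'I_m) : (w k *m B1 *m U') 0 j = (k == j :> nat)%:R.
  have [k_lt | k_ge] := ltnP k m.
    transitivity ((row (Ordinal k_lt) N *m U') 0 j); first by rewrite rowK.
    by rewrite -row_mul NU' !mxE.
  rewrite -wS_ker w_gt ?ltnS // !mul0mx mxE eqn_leq [(k <= j)%N]leqNgt.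
  by rewrite (leq_trans (ltn_ord j) k_ge).
have wB0 k (j : 'I_m) : (w k *m B0 *m U') 0 j = (k == j.+1 :> nat)%:R.
  case: k => [|k]; first by rewrite w0_ker mul0mx mxE.
  by rewrite wS_ker wB1.
have OB0 k j : (Omega *m B0 *m U') k j = (k == j.+1 :> nat)%:R.
  transitivity ((row k (Omega *m B0 *m U')) 0 j); first by rewrite [RHS]mxE.
  by rewrite !row_mul rowK wB0.
have OB1 k j : (Omega *m B1 *m U') k j = (k == j :> nat)%:R.
  transitivity ((row k (Omega *m B1 *m U')) 0 j); first by rewrite [RHS]mxE.
  by rewrite !row_mul rowK wB1.
(* The equations to be solved are indexed by all natural numbers, so the
   matrices are extended by 0. *)
pose ext (S : 'M[F]_m) i j := oapp (fun i' => oapp (S i') 0 (insub j)) 0 (insub i).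
have extE S (i j : 'I_m) : ext S i j = S i j by rewrite /ext !valK.
have ext_sym (S : 'M[F]_m) : S^T = S -> forall i j, ext S i j = ext S j i.
  move=> symS i j; rewrite /ext; case: (insub i); case: (insub j) => //= a b.
  by rewrite -[S in LHS]symS mxE.
have ext_alt (S : 'M[F]_m) : (forall i, S i i = 0) -> forall i, ext S i i = 0.
  by move=> altS i; rewrite /ext; case: (insub i) => //= a.
have sym_congr (B : 'M[F]_n) : B^T = B -> (U0 *m B *m U0^T)^T = U0 *m B *m U0^T.
  by move=> symB; rewrite !trmx_mul trmxK symB mulmxA.
have alt_congr (B : 'M[F]_n) : B^T = B -> (forall i, B i i = 0) ->
    forall i, (U0 *m B *m U0^T) i i = 0.
  move=> symB altB i; rewrite bilinear_entry.
  rewrite -[LHS]/(gram_value B (row i U0)) gram_value_sym // => [|a b]; last first.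
    by rewrite -[in LHS]symB mxE.
  by rewrite big1 // => a _; rewrite altB mul0r.
have [c cP] := antidiag_solution F2
  (ext_sym _ (sym_congr _ B0_sym)) (ext_alt _ (alt_congr _ B0_sym B0_alt))
  (ext_sym _ (sym_congr _ B1_sym)) (ext_alt _ (alt_congr _ B1_sym B1_alt)).
pose C : 'M[F]_(m, m.+1) := \matrix_(i, k) c i k.
pose U := U0 + C *m Omega.
have OBU (B : 'M[F]_n) : Omega *m B *m Omega^T = 0 ->
    Omega *m B *m U^T = Omega *m B *m U'.
  move=> isoB; rewrite linearD /= trmx_mul mulmxDr [_ *m (Omega^T *m _)]mulmxA isoB.
  by rewrite mul0mx addr0 trmxK.
have UBU (B : 'M[F]_n) : B^T = B -> Omega *m B *m Omega^T = 0 ->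
    U *m B *m U^T = U0 *m B *m U0^T + (C *m (Omega *m B *m U') +
                                       (C *m (Omega *m B *m U'))^T).
  move=> symB isoB; have UBE l (V : 'M[F]_(n, l)) :
      U *m B *m V = U0 *m B *m V + C *m (Omega *m B *m V).
    by rewrite /U !mulmxDl !mulmxA.
  have U0BU : U0 *m B *m U^T = (U *m B *m U0^T)^T.
    by rewrite !trmx_mul trmxK symB mulmxA.
  by rewrite UBE OBU // U0BU UBE linearD /= sym_congr // trmxK -addrA [_^T + _]addrC.
have C_entry (X : 'M[F]_(m.+1, m)) d i j :
    (forall k j, X k j = (k == d j :> nat)%:R) -> (d j < m.+1)%N ->
  (C *m X) i j = c i (d j).
  move=> XE dj; rewrite mxE (bigD1 (Ordinal dj)) //= big1 => [|k kd].
    by rewrite XE eqxx mulr1 mxE addr0.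
  by rewrite XE -[d j]/(val (Ordinal dj)) val_eqE (negPf kd) mulr0.
have UB0 : U *m B0 *m U^T = 0.
  apply/matrixP => i j; rewrite UBU // [LHS]mxE [X in _ + X]mxE [X in _ + (_ + X)]mxE.
  rewrite !(C_entry _ S) // ?ltnS //.
  by rewrite [X in _ + X](cP i j).2 extE addrr_pchar2 // mxE.
have UB1 : U *m B1 *m U^T = 0.
  apply/matrixP => i j; rewrite UBU // [LHS]mxE [X in _ + X]mxE [X in _ + (_ + X)]mxE.
  rewrite !(C_entry _ id) // ?ltnS 1?ltnW //.
  by rewrite [X in _ + X](cP i j).1 extE addrr_pchar2 // mxE.
exists U; split=> // [|k j|k j]; rewrite ?OBU //.
apply: inj_row_free => v; rewrite -[v]hsubmxK mul_row_col => v0.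
have vr0 : rsubmx v = 0.
  apply/rowP => j; have := congr1 (fun M => M *m B1 *m Omega^T) v0.
  rewrite !mulmxDl -!(mulmxA (lsubmx v)) iso1 mulmx0 add0r !mul0mx.
  have -> : rsubmx v *m U *m B1 *m Omega^T = rsubmx v *m (Omega *m B1 *m U^T)^T.
    by rewrite !trmx_mul trmxK B1_sym !mulmxA.
  move/rowP/(_ (lift ord_max j)); rewrite OBU // mxE (bigD1 j) //= big1 => [|k kj].
    by rewrite [_^T _ _]mxE OB1 lift_max eqxx mulr1 addr0 => ->; rewrite !mxE.
  by rewrite [_^T _ _]mxE OB1 lift_max val_eqE eq_sym (negPf kj) mulr0.
move: v0; rewrite vr0 mul0mx addr0 => /eqP.
by rewrite mulmx_free_eq0 ?coef_row_free // => /eqP ->; rewrite row_mx0.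
Qed.

End KroneckerForm.

(** Isotropy of [V] means that the Gram matrix of the restricted form is
    symmetric. *)
Lemma gram_value_isotropic (R : comNzRingType) k n (G : 'M[R]_n) (V : 'M[R]_(k, n)) y :
    2%N \in [pchar R] -> V *m gram_polar G *m V^T = 0 ->
  gram_value G (y *m V) = \sum_i (V *m G *m V^T) i i * y 0 i ^+ 2.
Proof.
move=> R2 isoV; rewrite gram_value_comb gram_value_sym // => i j.
have : V *m G *m V^T + (V *m G *m V^T)^T = 0.
  by rewrite !trmx_mul trmxK mulmxA -mulmxDl -mulmxDr.
move: (_ *m V^T) => T /matrixP/(_ i j)/eqP.
by rewrite !mxE addr_eq0 oppr_pchar2 // => /eqP.
Qed.

Definition gram_pencil (F : fieldType) n (G0 G1 : 'M[F]_n) : 'M[{poly F}]_n :=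
  map_mx polyC G0 + 'X *: map_mx polyC G1.

Section PencilNormalForm.

Variables (F : fieldType) (F2 : 2%N \in [pchar F]) (m : nat).
Variables (G0 G1 : 'M[F]_((2 * m).+1)).
Hypothesis reg : pencil_regular G0 G1.

Let B0 := gram_polar G0.
Let B1 := gram_polar G1.
Let omega := pf_vector (gram_polar (gram_pencil G0 G1)).
Let w l : 'rV[F]_((2 * m).+1) := \row_j (omega 0 j)`_l.

Lemma gram_polar_pencil i j :
  gram_polar (gram_pencil G0 G1) i j = (B0 i j)%:P + B1 i j *: 'X.
Proof.
by rewrite /B0 /B1 /gram_pencil !mxE -mul_polyC !rmorphD /=; ring.
Qed.

Lemma size_omega (j : 'I_((2 * m).+1)) : (size (omega 0%R j) <= m.+1)%N.
Proof. by rewrite mxE; apply: (haf_pencil _ _ gram_polar_pencil).1. Qed.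

Lemma coef_omega_top : w m = pf_vector B1.
Proof.
by apply/rowP => j; rewrite !mxE; apply: (haf_pencil _ _ gram_polar_pencil).2.
Qed.

Lemma omega_specialize (K : fieldType) (iota : {rmorphism F -> K}) (z : K) :
  \sum_(l < m.+1) z ^+ l *: map_mx iota (w l) =
  pf_vector (gram_polar (1 *: map_mx iota G0 + z *: map_mx iota G1)).
Proof.
pose g : {rmorphism {poly F} -> K} := horner_eval z \o map_poly iota.
have -> : gram_polar (1 *: map_mx iota G0 + z *: map_mx iota G1) =
          map_mx g (gram_polar (gram_pencil G0 G1)).
  apply/matrixP => i j; rewrite !mxE /g /= /horner_eval !rmorphD /= !rmorphM /=.
  by rewrite !map_polyC map_polyX !hornerE; ring.
rewrite map_pf_vector; apply/rowP => j; rewrite summxE mxE /g /= /horner_eval.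
rewrite (@horner_coef_wide _ m.+1) ?size_map_poly ?size_omega //.
by apply: eq_bigr => l _; rewrite !mxE coef_map mulrC.
Qed.

Lemma coef_omega_mul l (B : 'M[F]_((2 * m).+1)) i :
  (w l *m B) 0 i = \sum_j (omega 0 j)`_l * B j i.
Proof. by rewrite mxE; apply: eq_bigr => j _; rewrite [w l 0 j]mxE. Qed.

Lemma omega_ker i :
  \sum_j omega 0 j * ((B0 j i)%:P + B1 j i *: 'X) = 0.
Proof.
have P2 := rmorph_pchar (polyC : {rmorphism F -> {poly F}}) F2.
transitivity ((omega *m gram_polar (gram_pencil G0 G1)) 0 i).
  by rewrite [RHS]mxE; apply: eq_bigr => j _; rewrite gram_polar_pencil.
by rewrite pf_vector_ker ?mxE // => *; [apply: gram_polar_sym | apply: gram_polar_alt].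
Qed.

Lemma coef0_omega_ker : w 0 *m B0 = 0.
Proof.
apply/rowP => i; rewrite coef_omega_mul [RHS]mxE.
rewrite -[RHS](coef0 _ 0) -(omega_ker i) coef_sum.
apply: eq_bigr => j _.
by rewrite mulrDr coefD coefMC -scalerAr coefZ coefMX mulr0 addr0.
Qed.

Lemma coefS_omega_ker l : w l.+1 *m B0 = w l *m B1.
Proof.
apply/rowP => i; apply/eqP; rewrite -subr_eq0 oppr_pchar2 //; apply/eqP.
rewrite !coef_omega_mul -[RHS](coef0 _ l.+1) -(omega_ker i) coef_sum -big_split /=.
apply: eq_bigr => j _.
by rewrite mulrDr coefD coefMC -scalerAr coefZ coefMX /= (mulrC (B1 j i)).
Qed.

Lemma coef_omega_gt l : (m < l)%N -> w l = 0.
Proof.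
move=> l_gt; apply/rowP => j; rewrite [LHS]mxE [RHS]mxE.
by rewrite nth_default // (leq_trans (size_omega j)).
Qed.

Lemma coef_omega_top_neq0 : w m != 0.
Proof.
rewrite coef_omega_top; have := @regular_pf_vector F F idfun m G0 G1 0 1 F2 reg.
rewrite oner_eq0 orbT => /(_ isT); rewrite scale0r add0r scale1r.
by rewrite [map_mx _ _](_ : _ = G1) //; apply/matrixP => i j; rewrite mxE.
Qed.

Lemma ker_polar_top (x : 'rV_((2 * m).+1)) : x *m B1 = 0 -> exists c, x = c *: w m.
Proof.
move=> xB1; have /rV0Pn [j wj] := coef_omega_top_neq0.
exists (x 0 j / w m 0 j); apply/rowP => k; rewrite [RHS]mxE.
apply: (mulIf wj); rewrite mulrAC divfK // coef_omega_top.
by apply: ker_pf_vector => // a; [exact: gram_polar_sym | exact: gram_polar_alt].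
Qed.

Lemma omega_specialize_neq0 (K : fieldType) (iota : {rmorphism F -> K}) (z : K) :
  \sum_(l < m.+1) z ^+ l *: map_mx iota (w l) != 0.
Proof. by rewrite omega_specialize regular_pf_vector // oner_eq0. Qed.

Lemma omega_expand :
  omega = (\row_(l < m.+1) 'X^l) *m map_mx polyC (\matrix_(l < m.+1) w l).
Proof.
apply/rowP => j; rewrite [RHS]mxE; apply/polyP => l; rewrite coef_sum.
have wE (k : 'I_m.+1) : map_mx polyC (\matrix_(l < m.+1) w l) k j = ((omega 0 j)`_k)%:P.
  by rewrite [LHS]mxE; congr polyC; rewrite [LHS]mxE [LHS]mxE.
under eq_bigr => k _ do rewrite wE [X in X * _]mxE coefMC coefXn.
have [l_lt | l_ge] := ltnP l m.+1.
  rewrite (bigD1 (Ordinal l_lt)) //= eqxx mul1r big1 ?addr0 // => k kl.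
  by rewrite eq_sym (negPf (_ : val k != l)) ?mul0r.
rewrite nth_default ?(leq_trans (size_omega j)) // big1 // => k _.
by rewrite gtn_eqF ?mul0r // (leq_trans (ltn_ord k)).
Qed.

(** A regular pencil is a single Kronecker block; the coefficients of the
    sub-Pfaffian vector [omega] form one half of its canonical basis, and the
    values of the two quadratic forms on them are the coefficients of the
    half-discriminant. *)
Lemma pencil_normal_form :
  exists (W : 'M[F]_(m.+1, (2 * m).+1)) (U : 'M[F]_(m, (2 * m).+1)),
  [/\ row_free (col_mx W U),
     [/\ W *m B0 *m W^T = 0, U *m B0 *m U^T = 0 &
         forall k j, (W *m B0 *m U^T) k j = (k == j.+1 :> nat)%:R],
     [/\ W *m B1 *m W^T = 0, U *m B1 *m U^T = 0 &
         forall k j, (W *m B1 *m U^T) k j = (k == j :> nat)%:R] &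
     gram_value (gram_pencil G0 G1) omega =
       \sum_(l < m.+1) ((W *m G0 *m W^T) l l *: 'X^(2 * l) +
                        (W *m G1 *m W^T) l l *: 'X^((2 * l).+1))].
Proof.
have B0s : B0^T = B0 by apply/matrixP => i j; rewrite mxE; apply: gram_polar_sym.
have B1s : B1^T = B1 by apply/matrixP => i j; rewrite mxE; apply: gram_polar_sym.
have B0a i : B0 i i = 0 by apply: gram_polar_alt.
have B1a i : B1 i i = 0 by apply: gram_polar_alt.
have [U [free U0 U1 WU0 WU1]] :=
  kronecker_form F2 B0s B1s B0a B1a coef_omega_gt coef0_omega_ker
    coefS_omega_ker ker_polar_top omega_specialize_neq0.
have [W0 W1] := Omega_isotropic m B0s B1s coef0_omega_ker coefS_omega_ker.
exists (\matrix_(l < m.+1) w l), U; split=> //.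
move: (\matrix_(l < m.+1) w l) omega_expand W0 W1 => W -> W0 W1.
have P2 := rmorph_pchar (polyC : {rmorphism F -> {poly F}}) F2.
have isoC (G : 'M[F]_((2 * m).+1)) : W *m gram_polar G *m W^T = 0 ->
    gram_value (map_mx polyC G) ((\row_(l < m.+1) 'X^l) *m map_mx polyC W) =
    \sum_(l < m.+1) (W *m G *m W^T) l l *: 'X^(2 * l).
  move=> isoW; rewrite gram_value_isotropic // ?map_trmx -?map_gram_polar -!map_mxM.
    apply: eq_bigr => l _; rewrite [map_mx _ _ l l]mxE mul_polyC.
    by rewrite [(\row_(_ < _) _) 0 l]mxE -exprM (mulnC (l : nat)).
  by rewrite isoW map_mx0.
have -> : gram_pencil G0 G1 = 1 *: map_mx polyC G0 + 'X *: map_mx polyC G1.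
  by rewrite scale1r.
rewrite gram_valueD mul1r !isoC // mulr_sumr -big_split; apply: eq_bigr => l _ /=.
by rewrite -scalerAr -exprS.
Qed.
End PencilNormalForm.

(** * Quadratic forms as polynomials *)

Definition gram_mpoly (R : comNzRingType) (n : nat) (G : 'M[R]_n) : {mpoly R[n]} :=
  \sum_i \sum_j G i j *: ('X_i * 'X_j).

Lemma map_gram_mpoly (R S : comNzRingType) (g : {rmorphism R -> S}) n (G : 'M[R]_n) :
  map_mpoly g (gram_mpoly G) = gram_mpoly (map_mx g G).
Proof.
rewrite rmorph_sum; apply: eq_bigr => i _; rewrite rmorph_sum; apply: eq_bigr => j _.
by rewrite /= map_mpolyZ rmorphM /= !map_mpolyX mxE.
Qed.

Lemma meval_gram_mpoly (R : comNzRingType) n (G : 'M[R]_n) (v : 'I_n -> R) :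
  (gram_mpoly G).@[v] = gram_value G (\row_i v i).
Proof.
rewrite gram_valueE rmorph_sum; apply: eq_bigr => i _.
rewrite rmorph_sum; apply: eq_bigr => j _.
by rewrite /= mevalZ mevalM !mevalXU !mxE.
Qed.

Lemma mderiv_mpolyXU (R : comNzRingType) n (i j : 'I_n) :
  mderiv j 'X_i = (i == j)%:R :> {mpoly R[n]}.
Proof.
rewrite mderivX mnm1E; case: eqP => [-> | _]; last by rewrite scale0r.
have -> : (U_(j) - U_(j) = 0)%MM by apply/mnmP => l; rewrite mnmBE subnn mnm0E.
by rewrite mpolyX0 scale1r.
Qed.

Lemma meval_mderiv_gram_mpoly (R S : comNzRingType) (g : {rmorphism R -> S}) n
    (G : 'M[R]_n) (x : 'rV[S]_n) j :
  (map_mpoly g (mderiv j (gram_mpoly G))).@[fun i => x 0 i] =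
  (x *m gram_polar (map_mx g G)) 0 j.
Proof.
have -> : mderiv j (gram_mpoly G) = \sum_i (gram_polar G) i j *: 'X_i.
  transitivity (\sum_i \sum_k (G i k *: ((i == j)%:R * 'X_k) +
                               G i k *: ('X_i * (k == j)%:R) : {mpoly R[n]})).
    rewrite raddf_sum; apply: eq_bigr => i _; rewrite raddf_sum; apply: eq_bigr => k _.
    by rewrite /= mderivZ mderivM !mderiv_mpolyXU scalerDr.
  transitivity (\sum_i \sum_k G i k *: ((i == j)%:R * 'X_k : {mpoly R[n]}) +
                \sum_i \sum_k G i k *: ('X_i * (k == j)%:R : {mpoly R[n]})).
    by rewrite -big_split; apply: eq_bigr => i _; rewrite big_split.
  rewrite (bigD1 j) //= [X in _ + X + _]big1 => [|i ij]; last first.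
    by rewrite big1 // => k _; rewrite (negPf ij) mul0r scaler0.
  rewrite addr0 -big_split /=; apply: eq_bigr => i _; rewrite eqxx mul1r (bigD1 j) //=.
  rewrite big1 => [|k kj]; last by rewrite (negPf kj) mulr0 scaler0.
  by rewrite eqxx mulr1 addr0 -scalerDl !mxE addrC.
have -> : map_mpoly g (\sum_i (gram_polar G) i j *: 'X_i) =
          \sum_i gram_polar (map_mx g G) i j *: 'X_i.
  rewrite rmorph_sum; apply: eq_bigr => i _.
  by rewrite /= map_mpolyZ map_mpolyX -map_gram_polar [in RHS]mxE.
rewrite rmorph_sum [RHS]mxE; apply: eq_bigr => i _.
by rewrite /= mevalZ mevalXU mulrC.
Qed.

Lemma half_disc_gram_mpoly (R : comNzRingType) m (G : 'M[R]_((2 * m).+1)) :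
  2%N \in [pchar R] ->
  half_disc (gram_mpoly G) = gram_value G (pf_vector (gram_polar G)).
Proof.
move=> R2; have polarE : polar_mx (gram_mpoly G) = gram_polar G.
  apply/matrixP => j k; rewrite [LHS]mxE !meval_gram_mpoly.
  have deltaE (l : 'I_(2 * m).+1) :
      (\row_i (i == l)%:R : 'rV[R]_((2 * m).+1)) = delta_mx 0 l.
    by apply/rowP => i; rewrite !mxE.
  have -> : (\row_i ((i == j)%:R + (i == k)%:R) : 'rV[R]_((2 * m).+1)) =
            delta_mx 0 j + delta_mx 0 k.
    by apply/rowP => i; rewrite !mxE.
  rewrite !deltaE /gram_value linearD /= !mulmxDl !mulmxDr -!rowE !trmx_delta.
  rewrite -!colE !mxE; ring.
rewrite /half_disc polarE meval_gram_mpoly; congr gram_value; apply/rowP => i.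
by rewrite mxE pf_vectorE // => *; apply: gram_polar_sym.
Qed.

Section QuadraticForm.

Variables (F : fieldType) (E : vectType F) (q : E -> F).
Hypothesis qP : quadratic_form q.

(** Upper triangular, so that the form is recovered without dividing its polar
    form by 2. *)
Definition gram n (e : 'I_n -> E) : 'M[F]_n :=
  \matrix_(i, j) if i == j then q (e i)
                 else if (i < j)%N then polar q (e i) (e j) else 0.

Lemma quadratic_form_sum n (e : 'I_n -> E) (x : 'rV[F]_n) :
  q (\sum_i x 0 i *: e i) = gram_value (gram e) x.
Proof.
have [qZ qB] := qP; rewrite gram_valueE.
have qD u v : q (u + v) = q u + q v + polar q u v by rewrite /polar; ring.
have q0 : q 0 = 0 by rewrite -(scale0r 0) qZ expr0n mul0r.
elim: n e x => [|n IHn] e x; first by rewrite !big_ord0.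
have polar0 u : polar q u 0 = 0 by rewrite /polar addr0 q0 subr0 subrr.
have polarZl a u v : polar q (a *: u) v = a * polar q u v.
  have /= := (qB v).2 a u 0; rewrite addr0 => ->.
  by rewrite [polar q 0 v]/polar add0r q0 subr0 subrr addr0.
have polar_sum u v : polar q u (\sum_(i < n) v i *: e (lift ord0 i)) =
    \sum_(i < n) v i * polar q u (e (lift ord0 i)).
  elim/big_rec2: _ => [|i y1 y2 _ <-]; first exact: polar0.
  by have /= -> := (qB u).1 (v i) (e (lift ord0 i)) y2.
rewrite big_ord_recl qD qZ polarZl polar_sum.
pose x' : 'rV[F]_n := \row_i x 0 (lift ord0 i).
have -> : \sum_(i < n) x 0 (lift ord0 i) *: e (lift ord0 i) =
          \sum_(i < n) x' 0 i *: e (lift ord0 i).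
  by apply: eq_bigr => i _; rewrite mxE.
rewrite (IHn (fun i => e (lift ord0 i))) [RHS]big_ord_recl.
have row0 : \sum_j gram e ord0 j * (x 0 ord0 * x 0 j) = q (e ord0) * x 0 ord0 ^+ 2 +
    x 0 ord0 * \sum_(i < n) x 0 (lift ord0 i) * polar q (e ord0) (e (lift ord0 i)).
  rewrite big_ord_recl !mxE eqxx; congr (_ + _); rewrite mulr_sumr.
  by apply: eq_bigr => i _; rewrite !mxE /=; ring.
have rowS (i : 'I_n) : \sum_j gram e (lift ord0 i) j * (x 0 (lift ord0 i) * x 0 j) =
    \sum_j gram (fun i => e (lift ord0 i)) i j * (x' 0 i * x' 0 j).
  rewrite big_ord_recl !mxE /= mul0r add0r; apply: eq_bigr => j _.
  by rewrite !mxE (inj_eq lift_inj).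
by rewrite row0 (eq_bigr _ (fun i _ => rowS i)) addrAC mulrC.
Qed.
End QuadraticForm.

Lemma quad_poly_gram (F : fieldType) (E : vectType F) n (e : n.-tuple E) (q : E -> F) :
  quad_poly e q = gram_mpoly (gram q (tnth e)).
Proof.
rewrite /quad_poly /gram_mpoly -big_split /=; apply: eq_bigr => i _.
rewrite [RHS](bigD1 i) //= !mxE eqxx -expr2; congr (_ + _).
rewrite big_mkcond [RHS]big_mkcond /=; apply: eq_bigr => j _; rewrite !mxE eq_sym.
case: eqP => [-> | _] /=; first by rewrite ltnn.
by case: ifP; rewrite ?scale0r.
Qed.

Lemma gram_polarD (R : comNzRingType) n (a b : R) (G H : 'M[R]_n) :
  gram_polar (a *: G + b *: H) = a *: gram_polar G + b *: gram_polar H.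
Proof. by apply/matrixP => i j; rewrite !mxE; ring. Qed.

(** Smoothness and codimension refer to the same local dimension, so that the
    Jacobian has rank 2 at every point [x] of the base locus; its rows are the
    linear forms polar to [x]. *)
Lemma regular_pair_pencil (F : fieldType) (E : vectType F) n (e : n.-tuple E)
    (q0 q1 : E -> F) :
  regular_pair e q0 q1 -> pencil_regular (gram q0 (tnth e)) (gram q1 (tnth e)).
Proof.
move=> [smoothX [_ codimX]] K iota x s t x0 x_0 x_1 xst.
have evalE (q : E -> F) : (map_mpoly iota (quad_poly e q)).@[fun i => x 0 i] =
    gram_value (map_mx iota (gram q (tnth e))) x.
  rewrite quad_poly_gram map_gram_mpoly meval_gram_mpoly; congr gram_value.
  by apply/rowP => i; rewrite mxE.
have px : proj_point [:: quad_poly e q0; quad_poly e q1] iota (fun i => x 0 i).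
  split; first exact/rV0Pn.
  by move=> f; rewrite !inE => /orP[] /eqP ->; rewrite evalE.
have [d [chd maxd] rank_d] := smoothX K iota _ px.
have [d' [chd' maxd'] codim_d'] := codimX K iota _ px.
have dd' : d = d' by apply/eqP; rewrite eqn_leq maxd' // maxd.
move: rank_d; rewrite dd' -codim_d' => /addIn rank2.
pose J := jacobian_at [:: quad_poly e q0; quad_poly e q1] iota (fun i => x 0 i).
have Jfree : row_free J by rewrite /row_free rank2.
move: xst; rewrite gram_polarD mulmxDr -!scalemxAr => /rowP xst.
have : (\row_(i < 2) (if i == 0 then s else t)) *m J = 0.
  apply/rowP => j; have xstj := xst j.
  rewrite [LHS]mxE /= big_ord_recl big_ord1 ![J _ j]mxE /=.
  rewrite !quad_poly_gram !meval_mderiv_gram_mpoly ![(\row_(_ < 2) _) 0 _]mxE /=.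
  by rewrite -[RHS]xstj !mxE.
move/eqP; rewrite mulmx_free_eq0 // => /eqP/rowP st0.
by split; [have := st0 0 | have := st0 1]; rewrite !mxE.
Qed.

(** The half-discriminant is homogeneous of known degree, so setting [t_0 = 1]
    and [t_1 = X] keeps all its coefficients while allowing univariate
    polynomials to be used. *)
Lemma half_disc_pencil_dehomogenize (F : fieldType) (E : vectType F) m
    (e : ((2 * m).+1).-tuple E) (q0 q1 : E -> F) : 2%N \in [pchar F] ->
  let P := gram_pencil (gram q0 (tnth e)) (gram q1 (tnth e)) in
  mmap polyC (fun i : 'I_2 => if i == 0 then 1 else 'X) (half_disc_pencil e q0 q1) =
  gram_value P (pf_vector (gram_polar P)).
Proof.
move=> F2 P.
pose g : {rmorphism {mpoly F[2]} -> {poly F}} :=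
  mmap polyC (fun i : 'I_2 => if i == 0 then 1 else 'X).
have gX (i : 'I_2) : g 'X_i = if i == 0 then 1 else 'X by rewrite /g /= mmapX mmap1U.
have gC c : g c%:MP = c%:P by rewrite /g /= mmapC.
pose C := @mpolyC 2 F.
rewrite -/(g _) /half_disc_pencil !quad_poly_gram !map_gram_mpoly.
set G0 := gram q0 _; set G1 := gram q1 _.
have -> : 'X_(ord0 : 'I_2) *: gram_mpoly (map_mx C G0) +
    'X_(ord_max : 'I_2) *: gram_mpoly (map_mx C G1) =
    gram_mpoly ('X_(ord0 : 'I_2) *: map_mx C G0 + 'X_(ord_max : 'I_2) *: map_mx C G1).
  rewrite /gram_mpoly !scaler_sumr -big_split; apply: eq_bigr => i _ /=.
  rewrite !scaler_sumr -big_split; apply: eq_bigr => j _ /=.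
  by rewrite !scalerA -scalerDl !mxE.
rewrite half_disc_gram_mpoly; last first.
  exact: (rmorph_pchar (@mpolyC 2 F : {rmorphism F -> {mpoly F[2]}})).
rewrite -map_gram_value -map_pf_vector map_gram_polar.
suff -> : map_mx g ('X_(ord0 : 'I_2) *: map_mx C G0 +
                    'X_(ord_max : 'I_2) *: map_mx C G1) = P.
  by [].
by apply/matrixP => i j; rewrite !mxE rmorphD !rmorphM /= !gX !gC mul1r.
Qed.

Lemma gram_value_add (R : comNzRingType) n (G : 'M[R]_n) x y :
  gram_value G (x + y) =
  gram_value G x + gram_value G y + (x *m gram_polar G *m y^T) 0 0.
Proof.
have trE : (y *m G *m x^T) 0 0 = (x *m G^T *m y^T) 0 0.
  transitivity ((y *m G *m x^T)^T 0 0); first by rewrite [RHS]mxE.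
  by rewrite !trmx_mul trmxK mulmxA.
rewrite /gram_value linearD /= mulmxDr !mulmxDl !mulmxDr mulmxDl.
have addE (A B : 'M[R]_1) : (A + B) 0 0 = A 0 0 + B 0 0 by rewrite mxE.
by rewrite !addE -trE; ring.
Qed.

(** * The normal form *)

(** By isotropy each block contributes a combination of squares, and the two
    blocks interact through the polar form only. *)
Lemma gram_value_blocks (R : comNzRingType) k l n (G : 'M[R]_n) (W : 'M[R]_(k, n))
    (U : 'M[R]_(l, n)) (x : 'rV[R]_k) (y : 'rV[R]_l) :
    2%N \in [pchar R] ->
    W *m gram_polar G *m W^T = 0 -> U *m gram_polar G *m U^T = 0 ->
  gram_value G (x *m W + y *m U) =
    \sum_i (W *m G *m W^T) i i * x 0 i ^+ 2 +
    \sum_j (\sum_i x 0 i * (W *m gram_polar G *m U^T) i j) * y 0 j +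
    \sum_j (U *m G *m U^T) j j * y 0 j ^+ 2.
Proof.
move=> R2 isoW isoU; rewrite gram_value_add !gram_value_isotropic // addrAC.
congr (_ + _ + _).
have -> : x *m W *m gram_polar G *m (y *m U)^T =
          x *m (W *m gram_polar G *m U^T) *m y^T by rewrite trmx_mul !mulmxA.
move: (W *m _ *m _) => T; rewrite mxE; apply: eq_bigr => j _.
by rewrite [y^T _ _]mxE mxE.
Qed.

Lemma sum_mul_delta (R : nzRingType) n (f : 'I_n -> R) d (dn : (d < n)%N) :
  \sum_k f k * (k == d :> nat)%:R = f (Ordinal dn).
Proof.
rewrite (bigD1 (Ordinal dn)) //= eqxx mulr1 big1 ?addr0 // => k kd.
by rewrite -[d]/(val (Ordinal dn)) val_eqE (negPf kd) mulr0.
Qed.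

(** Linear independence is tested on the vectors of [E] whose coordinates are
    the rows of [M]. *)
Lemma dual_basis (F : fieldType) (E : vectType F) n k (e : n.-tuple E)
    (M : 'M[F]_(k, n)) (N : 'M[F]_(n, k)) (t : k.-tuple 'Hom(E, F^o)) :
    basis_of {:E} e -> \dim {:E} = k -> M *m N = 1%:M ->
    (forall (i : 'I_k) v, t`_i v = ((\row_j coord e j v) *m N) 0 i) ->
  basis_of {:'Hom(E, F^o)} t.
Proof.
move=> be dimE MN tE; rewrite basisEfree subvf size_tuple.
have -> : \dim {:'Hom(E, F^o)} = k by rewrite dimvf /dim /= muln1 -dimE dimvf.
rewrite leqnn !andbT; apply/freeP => c c0 i.
pose b := \sum_j M i j *: e`_j.
have coord_b : \row_j coord e j b = row i M.
  by apply/rowP => j; rewrite !mxE coord_sum_free // (basis_free be).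
have := congr1 (fun f : 'Hom(E, F^o) => f b) c0; rewrite sum_lfunE zero_lfunE.
rewrite (bigD1 i) //= big1 => [|l li]; rewrite scale_lfunE tE coord_b -row_mul MN !mxE.
  by rewrite eqxx addr0 => <-; rewrite [RHS]mulr1.
by rewrite eq_sym (negPf li); apply: mulr0.
Qed.

Lemma coord_quadratic_form (F : fieldType) (E : vectType F) (q : E -> F) n
    (e : n.-tuple E) v : quadratic_form q -> basis_of {:E} e ->
  q v = gram_value (gram q (tnth e)) (\row_j coord e j v).
Proof.
move=> qP be; rewrite -quadratic_form_sum // [in LHS](coord_basis be (memvf v)).
by congr q; apply: eq_bigr => i _; rewrite mxE (tnth_nth 0).
Qed.

Theorem theorem1p1 (F : fieldType) (hF : 2%N \in [pchar F])
    (E : vectType F) (m : nat) (hm : (0 < m)%N)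
    (hE : \dim {:E} = (2 * m).+1)
    (q0 q1 : E -> F) (hq0 : quadratic_form q0) (hq1 : quadratic_form q1)
    (vol : (2 * m).+1.-tuple E -> F) (hvol : volume_form vol)
    (e : (2 * m).+1.-tuple E) (he : basis_of {:E} e) (hvole : vol e = 1)
    (hreg : regular_pair e q0 q1)
    (a : (2 * m).+2.-tuple F)
    (ha : half_disc_pencil e q0 q1 =
          \sum_(i < (2 * m).+2) a`_i *:
            ('X_(ord0 : 'I_2) ^+ ((2 * m).+1 - i) * 'X_(ord_max : 'I_2) ^+ i)) :
  exists (x : m.+1.-tuple 'Hom(E, F^o)) (y : m.-tuple 'Hom(E, F^o))
         (r : (2 * m).-tuple F),
    [/\ basis_of {:'Hom(E, F^o)} (x ++ y),
        forall v : E,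
          q0 v = \sum_(i < m.+1) a`_(2 * i) * x`_i v ^+ 2 +
                 \sum_(i < m) x`_i.+1 v * y`_i v +
                 \sum_(i < m) r`_(2 * i).+1 * y`_i v ^+ 2
      & forall v : E,
          q1 v = \sum_(i < m.+1) a`_(2 * i).+1 * x`_i v ^+ 2 +
                 \sum_(i < m) x`_i v * y`_i v +
                 \sum_(i < m) r`_(2 * i) * y`_i v ^+ 2].
Proof.
have reg := regular_pair_pencil hreg.
set G0 := gram q0 (tnth e) in reg; set G1 := gram q1 (tnth e) in reg.
have [W [U [MT [W0 U0 WU0] [W1 U1 WU1] discE]]] := pencil_normal_form hF reg.
have [a0 a1] : (forall l : 'I_m.+1, (W *m G0 *m W^T) l l = a`_(2 * l)) /\
               (forall l : 'I_m.+1, (W *m G1 *m W^T) l l = a`_(2 * l).+1).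
  have := half_disc_pencil_dehomogenize e q0 q1 hF; rewrite /= discE ha.
  pose g : {rmorphism {mpoly F[2]} -> {poly F}} :=
    mmap polyC (fun i : 'I_2 => if i == 0 then 1 else 'X).
  rewrite -[mmap _ _ _]/(g _) rmorph_sum /= => aE.
  have {}aE : \poly_(i < (2 * m).+2) a`_i = \sum_(l < m.+1)
      ((W *m G0 *m W^T) l l *: 'X^(2 * l) + (W *m G1 *m W^T) l l *: 'X^((2 * l).+1)).
    rewrite -aE poly_def; apply: eq_bigr => i _.
    rewrite mmapZ -[mmap _ _ _]/(g _) rmorphM !rmorphXn /= !mmapX !mmap1U /=.
    by rewrite expr1n mul1r mul_polyC.
  have coefE k : (k < (2 * m).+2)%N -> a`_k = \sum_(l < m.+1)
      ((W *m G0 *m W^T) l l * (k == (2 * l)%N)%:R +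
       (W *m G1 *m W^T) l l * (k == (2 * l).+1%N)%:R).
    move=> k_lt; have := congr1 (fun p : {poly F} => p`_k) aE.
    rewrite coef_poly k_lt coef_sum => ->; apply: eq_bigr => l _.
    by rewrite coefD !coefZ !coefXn.
  split=> l; rewrite coefE; try by have := ltn_ord l; lia.
    rewrite (bigD1 l) //= big1 => [|k kl].
      by rewrite eqxx ltn_eqF // mulr1 mulr0 !addr0.
    have kl' : (k != l :> nat) by rewrite val_eqE.
    have -> : (2 * l == 2 * k)%N = false by lia.
    have -> : (2 * l == (2 * k).+1)%N = false by lia.
    by rewrite !mulr0 addr0.
  rewrite (bigD1 l) //= big1 => [|k kl].
    by rewrite eqxx gtn_eqF // mulr1 mulr0 add0r addr0.
  have kl' : (k != l :> nat) by rewrite val_eqE.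
  have -> : ((2 * l).+1 == (2 * k).+1)%N = false by lia.
  have -> : ((2 * l).+1 == 2 * k)%N = false by lia.
  by rewrite !mulr0 addr0.
pose M := col_mx W U.
have [N' MN'] := row_freeP MT.
(* The rows of [M] are the coordinates of the new basis of [E], so those of
   [v] in that basis are the coordinates of [v] in [e] times [N]. *)
have [N NM] : exists N, N *m M = 1%:M.
  apply/row_fullP; rewrite /row_full; move/eqP: MT => ->; lia.
have {N' MN'} MN : M *m N = 1%:M.
  suff -> : N = N' by [].
  by rewrite -[N]mulmx1 -MN' mulmxA NM mul1mx.
pose c v : 'rV[F]_((2 * m).+1) := \row_j coord e j v.
pose f (r : 'I_(m.+1 + m)) : 'Hom(E, F^o) :=
  \sum_s N s r *: linfun (coord e s : E -> F^o).
have fE r v : f r v = (c v *m N) 0 r.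
  rewrite sum_lfunE mxE; apply: eq_bigr => s _.
  by rewrite scale_lfunE lfunE mxE mulrC.
pose x : m.+1.-tuple 'Hom(E, F^o) := [tuple f (lshift m i) | i < m.+1].
pose y : m.-tuple 'Hom(E, F^o) := [tuple f (rshift m.+1 i) | i < m].
have xE (i : 'I_m.+1) v : x`_i v = (c v *m N) 0 (lshift m i).
  by rewrite -tnth_nth tnth_mktuple fE.
have yE (i : 'I_m) v : y`_i v = (c v *m N) 0 (rshift m.+1 i).
  by rewrite -tnth_nth tnth_mktuple fE.
pose r : (2 * m).-tuple F := [tuple of mkseq (fun k =>
  oapp (fun i : 'I_m => if odd k then (U *m G0 *m U^T) i i else (U *m G1 *m U^T) i i)
       0 (insub k./2)) (2 * m)].
have r0 (i : 'I_m) : r`_(2 * i).+1 = (U *m G0 *m U^T) i i.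
  rewrite nth_mkseq; last by have := ltn_ord i; lia.
  by rewrite mul2n /= odd_double uphalf_double valK.
have r1 (i : 'I_m) : r`_(2 * i) = (U *m G1 *m U^T) i i.
  rewrite nth_mkseq; last by have := ltn_ord i; lia.
  by rewrite mul2n odd_double doubleK valK.
have cE v : c v = (\row_i x`_i v) *m W + (\row_j y`_j v) *m U.
  rewrite -mul_row_col -/M -[LHS]mulmx1 -NM mulmxA; congr (_ *m _).
  rewrite -[LHS]hsubmxK; congr row_mx; apply/rowP => i; rewrite [LHS]mxE [RHS]mxE.
    exact/esym/xE.
  exact/esym/yE.
exists x, y, r; split=> [|v|v].
- have xyP : (x ++ y)%SEQ = [tuple f i | i < m.+1 + m].
    apply: (@eq_from_nth _ 0) => [|k]; rewrite size_cat !size_tuple // => k_lt.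
    rewrite nth_cat size_tuple -[k in RHS]/(val (Ordinal k_lt)) nth_mktuple.
    have [k_small | k_big] := ltnP k m.+1.
      rewrite -[k in LHS]/(val (Ordinal k_small)) nth_mktuple; congr f.
      exact: val_inj.
    have kB : (k - m.+1 < m)%N by lia.
    rewrite -[(k - _)%N]/(val (Ordinal kB)) nth_mktuple; congr f.
    by apply: val_inj; rewrite /= subnKC.
  rewrite xyP; apply: (dual_basis (e := e) (M := M) (N := N)) => // [|i w].
    by rewrite hE; lia.
  by rewrite -tnth_nth tnth_mktuple fE.
- rewrite (coord_quadratic_form v hq0 he) -/G0 -/(c v) cE gram_value_blocks //.
  congr (_ + _ + _); apply: eq_bigr => i _; rewrite ?a0 ?r0 ![(\row_(_ < _) _) 0 _]mxE //.
  have i_lt : (i.+1 < m.+1)%N by rewrite ltnS.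
  under eq_bigr => k _ do rewrite WU0.
  by rewrite (sum_mul_delta _ i_lt) mxE.
- rewrite (coord_quadratic_form v hq1 he) -/G1 -/(c v) cE gram_value_blocks //.
  congr (_ + _ + _); apply: eq_bigr => i _; rewrite ?a1 ?r1 ![(\row_(_ < _) _) 0 _]mxE //.
  have i_lt : (i < m.+1)%N by rewrite ltnS ltnW.
  under eq_bigr => k _ do rewrite WU1.
  by rewrite (sum_mul_delta _ i_lt) mxE.
Qed.
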